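(* Let $r\ge1$ and let $A=(a_{ij})_{1\le i,j\le r}$ be in $M_q(r)$, i.e. $A$ is the $r\times r$ quantum matrix of generators of the quantum algebra $M_q(r)$. Then $$\frac{1}{\mathrm{Ferm}(A)}=\sum_{n=0}^\infty \mathrm{tr}\,S^n(A).$$
   Context: Let $K$ be a commutative ring and $q\in K$ an invertible element. Quantum matrix / $M_q(r)$: $M_q(r)$ is the unital associative $K$-algebra generated by $a_{ij}$, $1\le i,j\le r$, subject to the relations that for every $2\times2$ submatrix $\begin{pmatrix}a&b\\c&d\end{pmatrix}$ of $A=(a_{ij})$ (i.e. $a=a_{ij}$, $b=a_{ij'}$, $c=a_{i'j}$, $d=a_{i'j'}$ with $i<i'$, $j<j'$) one has $$ba=q\,ab,\quad ca=q\,ac,\quad db=q\,bd,\quad dc=q\,cd,\quad cb=bc,\quad ad=da+q^{-1}cb-q\,bc.$$ Quantum determinant: for an $n\times n$ matrix $B=(b_{ij})$, ${\det}_q(B)=\sum_{\pi\in S_n}(-q)^{-\mathrm{inv}(\pi)}b_{\pi_11}b_{\pi_22}\cdots b_{\pi_nn}$, where $\mathrm{inv}(\pi)$ is the number of pairs $i<j$ with $\pi_i>\pi_j$. $\mathrm{Ferm}(A)=\sum_{J\subset\{1,\dots,r\}}(-1)^{|J|}\det_q(A_J)$, where $A_J$ is the $J$ by $J$ submatrix of $A$ (rows and columns in increasing order), and $\det_q(A_\emptyset)=1$. Quantum symmetric powers: let $x_1,\dots,x_r$ be variables commuting with all $a_{ij}$ and satisfying $x_jx_i=q\,x_ix_j$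 for $i<j$, and let $X_i=\sum_{j=1}^r a_{ij}x_j$. $S^n(A)$ is the $n$-th symmetric power of $A$, acting on the degree $n$ part of the quantum space (with basis the ordered monomials $x_1^{m_1}\cdots x_r^{m_r}$, $m_1+\dots+m_r=n$) by $x_1^{m_1}\cdots x_r^{m_r}\mapsto X_1^{m_1}\cdots X_r^{m_r}$, and its trace is $$\mathrm{tr}\,S^n(A)=\sum_{m_1+\dots+m_r=n}G(m_1,\dots,m_r),$$ where $G(m_1,\dots,m_r)\in M_q(r)$ is the coefficient of $x_1^{m_1}x_2^{m_2}\cdots x_r^{m_r}$ in $X_1^{m_1}X_2^{m_2}\cdots X_r^{m_r}$. Infinite sums and inverse: $M_q(r)$ is graded with each $a_{ij}$ in degree $1$, and the identity takes place in its completion $\prod_{n\ge0}M_q(r)_n$, in which $\mathrm{Ferm}(A)$ (having degree-zero part $1$) is invertible. *)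

(* Defs.v *)
From HB Require Import structures.
From mathcomp Require Import all_boot all_order all_algebra all_fingroup.
From mathcomp Require Import generic_quotient ring_quotient.
From mathcomp Require Import boolp.
From mathcomp Require Import finmap.
From mathcomp.multinomials Require Import monalg.

Set Implicit Arguments.
Unset Strict Implicit.
Unset Printing Implicit Defensive.

Import GRing.Theory.

Local Open Scope ring_scope.
Local Open Scope quotient_scope.

Section TwoSidedIdeal.
Context {K : comNzRingType} {A : algType K}.

Inductive ideal_gen (P : A -> Prop) : A -> Prop :=
| ideal_gen_rel x : P x -> ideal_gen P x
| ideal_gen0 : ideal_gen P 0
| ideal_genB (x y : A) : ideal_gen P x -> ideal_gen P y -> ideal_gen P (x - y)
| ideal_genMl (u x : A) : ideal_gen P x -> ideal_gen P (u * x)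
| ideal_genMr (x u : A) : ideal_gen P x -> ideal_gen P (x * u).

Variable P : A -> Prop.

Lemma ideal_genD (x y : A) :
  ideal_gen P x -> ideal_gen P y -> ideal_gen P (x + y).
Proof.
move=> xI yI; rewrite -[y]opprK; apply: ideal_genB => //.
by rewrite -sub0r; apply: ideal_genB => //; exact: ideal_gen0.
Qed.

Lemma ideal_genZ k (x : A) : ideal_gen P x -> ideal_gen P (k *: x).
Proof. by move=> xI; rewrite -[x]mul1r scalerAl; exact: ideal_genMl. Qed.

Definition ideal_gen_pred : {pred A} := [pred x | `[< ideal_gen P x >]].

Fact ideal_gen_zmod_closed : zmod_closed ideal_gen_pred.
Proof.
split=> [|x y]; rewrite !inE; first by apply/asboolP; exact: ideal_gen0.
by move=> /asboolP xI /asboolP yI; apply/asboolP; exact: ideal_genB.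
Qed.

HB.instance Definition _ :=
  GRing.isZmodClosed.Build A ideal_gen_pred ideal_gen_zmod_closed.

(* The quotient A / (P). Properness of the ideal is required because algType
   excludes the zero ring. *)
Definition alg_quot (proper : ~ ideal_gen P 1) : Type :=
  Quotient.quot ideal_gen_pred.

End TwoSidedIdeal.

(* The operations of the quotient are sealed, so that failing unifications do
   not unfold into the quotient construction. *)
HB.lock Definition alg_pi (K : comNzRingType) (A : algType K) (P : A -> Prop)
    (h : ~ ideal_gen P 1) (x : A) : alg_quot h :=
  \pi_(Quotient.quot (ideal_gen_pred P)) x.
HB.lock Definition alg_repr (K : comNzRingType) (A : algType K) (P : A -> Prop)
    (h : ~ ideal_gen P 1) (x : alg_quot h) : A :=
  repr (x : Quotient.quot (ideal_gen_pred P)).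

HB.lock Definition alg_quot_zero (K : comNzRingType) (A : algType K)
    (P : A -> Prop) (h : ~ ideal_gen P 1) : alg_quot h := alg_pi h 0.
HB.lock Definition alg_quot_opp (K : comNzRingType) (A : algType K)
    (P : A -> Prop) (h : ~ ideal_gen P 1) (x : alg_quot h) : alg_quot h :=
  alg_pi h (- alg_repr x).
HB.lock Definition alg_quot_add (K : comNzRingType) (A : algType K)
    (P : A -> Prop) (h : ~ ideal_gen P 1) (x y : alg_quot h) : alg_quot h :=
  alg_pi h (alg_repr x + alg_repr y).
HB.lock Definition alg_quot_one (K : comNzRingType) (A : algType K)
    (P : A -> Prop) (h : ~ ideal_gen P 1) : alg_quot h := alg_pi h 1.
HB.lock Definition alg_quot_mul (K : comNzRingType) (A : algType K)
    (P : A -> Prop) (h : ~ ideal_gen P 1) (x y : alg_quot h) : alg_quot h :=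
  alg_pi h (alg_repr x * alg_repr y).
HB.lock Definition alg_quot_scale (K : comNzRingType) (A : algType K)
    (P : A -> Prop) (h : ~ ideal_gen P 1) (k : K) (x : alg_quot h) :
    alg_quot h := alg_pi h (k *: alg_repr x).

Section AlgebraQuotient.
Context {K : comNzRingType} {A : algType K} {P : A -> Prop}.
Variable h : ~ ideal_gen P 1.
Local Notation Q := (alg_quot h).
Local Notation pi := (alg_pi h).

HB.instance Definition _ := Choice.on Q.

Lemma alg_piP (x y : A) : pi x = pi y <-> ideal_gen P (x - y).
Proof.
rewrite alg_pi.unlock; split=> [/eqP|I].
  by rewrite -[_ == _]/(_ == _ %[mod Quotient.quot (ideal_gen_pred P)])
             -Quotient.idealrBE inE => /asboolP.
apply/eqP.
rewrite -[_ == _]/(_ == _ %[mod Quotient.quot (ideal_gen_pred P)]).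
by rewrite -Quotient.idealrBE inE; apply/asboolP.
Qed.

Lemma alg_reprK (x : Q) : pi (alg_repr x) = x.
Proof. by rewrite alg_pi.unlock alg_repr.unlock; exact: reprK. Qed.

Lemma alg_pi_surj (x : Q) : exists y, x = pi y.
Proof. by exists (alg_repr x); rewrite alg_reprK. Qed.

Lemma ideal_gen_repr (x : A) : ideal_gen P (alg_repr (pi x) - x).
Proof. by apply/alg_piP; rewrite alg_reprK. Qed.

Fact alg_quot_oppE (x : A) : alg_quot_opp (pi x) = pi (- x).
Proof.
rewrite alg_quot_opp.unlock; apply/alg_piP; rewrite -opprD -sub0r.
by apply: ideal_genB; [exact: ideal_gen0 | exact: ideal_gen_repr].
Qed.

Fact alg_quot_addE (x y : A) : alg_quot_add (pi x) (pi y) = pi (x + y).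
Proof.
rewrite alg_quot_add.unlock; apply/alg_piP; rewrite opprD addrACA.
by apply: ideal_genD; exact: ideal_gen_repr.
Qed.

Fact alg_quot_mulE (x y : A) : alg_quot_mul (pi x) (pi y) = pi (x * y).
Proof.
rewrite alg_quot_mul.unlock; apply/alg_piP; set x' := alg_repr _.
set y' := alg_repr _.
have -> : x' * y' - x * y = (x' - x) * y' + x * (y' - y).
  by rewrite mulrBl mulrBr addrA subrK.
apply: ideal_genD.
  by apply: ideal_genMr; exact: ideal_gen_repr.
by apply: ideal_genMl; exact: ideal_gen_repr.
Qed.

Fact alg_quot_scaleE k (x : A) : alg_quot_scale k (pi x) = pi (k *: x).
Proof.
rewrite alg_quot_scale.unlock; apply/alg_piP; rewrite -scalerBr.
by apply: ideal_genZ; exact: ideal_gen_repr.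
Qed.

Fact alg_quot_addA : associative (@alg_quot_add K A P h).
Proof.
move=> x y z; have [x' ->] := alg_pi_surj x; have [y' ->] := alg_pi_surj y.
by have [z' ->] := alg_pi_surj z; rewrite !alg_quot_addE addrA.
Qed.

Fact alg_quot_addC : commutative (@alg_quot_add K A P h).
Proof.
move=> x y; have [x' ->] := alg_pi_surj x; have [y' ->] := alg_pi_surj y.
by rewrite !alg_quot_addE addrC.
Qed.

Fact alg_quot_add0 : left_id (alg_quot_zero h) (@alg_quot_add K A P h).
Proof.
move=> x; have [x' ->] := alg_pi_surj x.
by rewrite alg_quot_zero.unlock alg_quot_addE add0r.
Qed.

Fact alg_quot_addN :
  left_inverse (alg_quot_zero h) (@alg_quot_opp K A P h)
    (@alg_quot_add K A P h).
Proof.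
move=> x; have [x' ->] := alg_pi_surj x.
by rewrite alg_quot_zero.unlock alg_quot_oppE alg_quot_addE addNr.
Qed.

HB.instance Definition _ := GRing.isZmodule.Build Q
  alg_quot_addA alg_quot_addC alg_quot_add0 alg_quot_addN.

Lemma alg_piD (x y : A) : pi (x + y) = pi x + pi y.
Proof. by rewrite -alg_quot_addE. Qed.

Lemma alg_pi0 : pi 0 = 0.
Proof. by rewrite -[0 in RHS]/(alg_quot_zero h) alg_quot_zero.unlock. Qed.

Lemma alg_piB (x y : A) : pi (x - y) = pi x - pi y.
Proof. by rewrite alg_piD -alg_quot_oppE. Qed.

HB.instance Definition _ := GRing.isZmodMorphism.Build A Q pi alg_piB.

Fact alg_quot_mulA : associative (@alg_quot_mul K A P h).
Proof.
move=> x y z; have [x' ->] := alg_pi_surj x; have [y' ->] := alg_pi_surj y.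
by have [z' ->] := alg_pi_surj z; rewrite !alg_quot_mulE mulrA.
Qed.

Fact alg_quot_mul1 : left_id (alg_quot_one h) (@alg_quot_mul K A P h).
Proof.
move=> x; have [x' ->] := alg_pi_surj x.
by rewrite alg_quot_one.unlock alg_quot_mulE mul1r.
Qed.

Fact alg_quot_mulr1 : right_id (alg_quot_one h) (@alg_quot_mul K A P h).
Proof.
move=> x; have [x' ->] := alg_pi_surj x.
by rewrite alg_quot_one.unlock alg_quot_mulE mulr1.
Qed.

Fact alg_quot_mulDl : left_distributive (@alg_quot_mul K A P h) +%R.
Proof.
move=> x y z; have [x' ->] := alg_pi_surj x; have [y' ->] := alg_pi_surj y.
have [z' ->] := alg_pi_surj z.
by rewrite -alg_piD !alg_quot_mulE mulrDl alg_piD.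
Qed.

Fact alg_quot_mulDr : right_distributive (@alg_quot_mul K A P h) +%R.
Proof.
move=> x y z; have [x' ->] := alg_pi_surj x; have [y' ->] := alg_pi_surj y.
have [z' ->] := alg_pi_surj z.
by rewrite -alg_piD !alg_quot_mulE mulrDr alg_piD.
Qed.

Fact alg_quot_one_neq0 : alg_quot_one h != 0.
Proof.
apply/eqP; rewrite alg_quot_one.unlock -alg_pi0 => /alg_piP.
by rewrite subr0.
Qed.

HB.instance Definition _ := GRing.Zmodule_isNzRing.Build Q
  alg_quot_mulA alg_quot_mul1 alg_quot_mulr1 alg_quot_mulDl alg_quot_mulDr
  alg_quot_one_neq0.

Lemma alg_pi1 : pi 1 = 1.
Proof. by rewrite -[1 in RHS]/(alg_quot_one h) alg_quot_one.unlock. Qed.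

Lemma alg_piM (x y : A) : pi (x * y) = pi x * pi y.
Proof. by rewrite -alg_quot_mulE. Qed.

Fact alg_pi_monoid_morphism : monoid_morphism pi.
Proof. by split; [exact: alg_pi1 | exact: alg_piM]. Qed.

HB.instance Definition _ :=
  GRing.isMonoidMorphism.Build A Q pi alg_pi_monoid_morphism.

Fact alg_quot_scaleA a b (x : Q) :
  alg_quot_scale a (alg_quot_scale b x) = alg_quot_scale (a * b) x.
Proof.
by have [x' ->] := alg_pi_surj x; rewrite !alg_quot_scaleE scalerA.
Qed.

Fact alg_quot_scale1 : left_id 1 (@alg_quot_scale K A P h).
Proof.
by move=> x; have [x' ->] := alg_pi_surj x; rewrite alg_quot_scaleE scale1r.
Qed.

Fact alg_quot_scaleDr : right_distributive (@alg_quot_scale K A P h) +%R.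
Proof.
move=> a x y; have [x' ->] := alg_pi_surj x; have [y' ->] := alg_pi_surj y.
by rewrite -alg_piD !alg_quot_scaleE scalerDr alg_piD.
Qed.

Fact alg_quot_scaleDl (x : Q) :
  {morph (@alg_quot_scale K A P h)^~ x : a b / a + b}.
Proof.
move=> a b; have [x' ->] := alg_pi_surj x.
by rewrite !alg_quot_scaleE scalerDl alg_piD.
Qed.

HB.instance Definition _ := GRing.Zmodule_isLmodule.Build K Q
  alg_quot_scaleA alg_quot_scale1 alg_quot_scaleDr alg_quot_scaleDl.

Lemma alg_piZ k (x : A) : pi (k *: x) = k *: pi x.
Proof. by rewrite -alg_quot_scaleE. Qed.

Fact alg_quot_scaleAl (a : K) (x y : Q) : a *: (x * y) = (a *: x) * y.
Proof.
have [x' ->] := alg_pi_surj x; have [y' ->] := alg_pi_surj y.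
by rewrite -alg_piM -!alg_piZ -alg_piM scalerAl.
Qed.

HB.instance Definition _ := GRing.Lmodule_isLalgebra.Build K Q alg_quot_scaleAl.

Fact alg_quot_scaleAr (a : K) (x y : Q) : a *: (x * y) = x * (a *: y).
Proof.
have [x' ->] := alg_pi_surj x; have [y' ->] := alg_pi_surj y.
by rewrite -alg_piM -!alg_piZ -alg_piM scalerAr.
Qed.

HB.instance Definition _ := GRing.Lalgebra_isAlgebra.Build K Q alg_quot_scaleAr.
HB.instance Definition _ := GRing.isScalable.Build K A Q *:%R pi alg_piZ.

End AlgebraQuotient.

(* The grading R = \bigoplus_n R_n is given by the projections of R onto its
   homogeneous components: R_n consists of the x with gcomp n x = x. *)
Record grading (R : nzRingType) := Grading {
  gcomp :> nat -> R -> R;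
  gcompB : forall n (x y : R), gcomp n (x - y) = gcomp n x - gcomp n y;
  gcomp_id : forall n m (x : R),
    gcomp n (gcomp m x) = if n == m then gcomp m x else 0;
  gcomp_fin : forall x : R, exists N, x = \sum_(n < N) gcomp n x;
  gcomp1 : gcomp 0 1 = 1;
  gcompM : forall n (x y : R),
    gcomp n (x * y) = \sum_(i < n.+1) gcomp i x * gcomp (n - i) y }.

Section GradingTheory.
Context {R : nzRingType} (g : grading R).

Lemma gcomp0 n : g n 0 = 0.
Proof. by rewrite -[X in g n X](subrr 0) gcompB subrr. Qed.

Lemma gcompN n (x : R) : g n (- x) = - g n x.
Proof. by rewrite -sub0r gcompB gcomp0 sub0r. Qed.

Lemma gcompD n (x y : R) : g n (x + y) = g n x + g n y.
Proof. by rewrite -[y in LHS]opprK gcompB gcompN opprK. Qed.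

Lemma gcomp_one n : g n 1 = (n == 0)%:R.
Proof. by rewrite -[in LHS](gcomp1 g) gcomp_id gcomp1; case: eqP. Qed.

HB.instance Definition _ n :=
  GRing.isZmodMorphism.Build R R (gcomp g n) (@gcompB R g n).

Definition homog n : {pred R} := [pred x | g n x == x].

Lemma homog_zmod_closed n : zmod_closed (homog n).
Proof.
split=> [|x y]; rewrite !inE ?gcomp0 // => /eqP hx /eqP hy.
by rewrite gcompB hx hy.
Qed.

HB.instance Definition _ n :=
  GRing.isZmodClosed.Build R (homog n) (homog_zmod_closed n).

Lemma gcomp_homog n (x : R) : g n x \in homog n.
Proof. by rewrite inE gcomp_id eqxx. Qed.

Lemma homogM m n (x y : R) :
  x \in homog m -> y \in homog n -> x * y \in homog (m + n).
Proof.
rewrite !inE => /eqP <- /eqP <-; rewrite gcompM.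
have lm : (m < (m + n).+1)%N by rewrite ltnS leq_addr.
rewrite (bigD1 (Ordinal lm)) //= addKn !gcomp_id !eqxx big1 ?addr0 //.
by move=> i /negPf ni; rewrite gcomp_id -[i == m :> nat]/(i == Ordinal lm) ni mul0r.
Qed.

Lemma homog1 : 1 \in homog 0.
Proof. by rewrite inE gcomp1. Qed.

(* \prod_n R_n, with the Cauchy product *)
Record completion : Type :=
  Completion { ccoef :> nat -> R; ccoefP : forall n, ccoef n \in homog n }.

HB.instance Definition _ := gen_eqMixin completion.
HB.instance Definition _ := gen_choiceMixin completion.

Lemma completion_ext (u v : completion) : u =1 v -> u = v.
Proof.
case: u v => [u uP] [v vP] /= /funext uv; case: _ / uv vP => vP.
by congr Completion; exact: Prop_irrelevance.
Qed.

Definition completion_zero : completion :=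
  Completion (fun n => rpred0 (homog n)).
Definition completion_opp (u : completion) : completion :=
  @Completion (fun n => - u n) (fun n => rpredNr (ccoefP u n)).
Definition completion_add (u v : completion) : completion :=
  @Completion (fun n => u n + v n) (fun n => rpredD (ccoefP u n) (ccoefP v n)).

Fact completion_addA : associative completion_add.
Proof. by move=> u v w; apply: completion_ext => n /=; exact: addrA. Qed.
Fact completion_addC : commutative completion_add.
Proof. by move=> u v; apply: completion_ext => n /=; exact: addrC. Qed.
Fact completion_add0 : left_id completion_zero completion_add.
Proof. by move=> u; apply: completion_ext => n /=; exact: add0r. Qed.
Fact completion_addN :
  left_inverse completion_zero completion_opp completion_add.
Proof. by move=> u; apply: completion_ext => n /=; exact: addNr. Qed.

HB.instance Definition _ := GRing.isZmodule.Build completion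
  completion_addA completion_addC completion_add0 completion_addN.

(* the inclusion of R = \bigoplus_n R_n in \prod_n R_n *)
Definition to_completion (x : R) : completion :=
  Completion (fun n => gcomp_homog n x).

Fact completion_mul_homog (u v : completion) n :
  \sum_(i < n.+1) u i * v (n - i)%N \in homog n.
Proof.
apply: rpred_sum => i _; have le_in : (i <= n)%N by rewrite -ltnS.
by have := homogM (ccoefP u i) (ccoefP v (n - i)); rewrite subnKC.
Qed.

Definition completion_mul (u v : completion) : completion :=
  Completion (completion_mul_homog u v).

Fact completion_mulA : associative completion_mul.
Proof.
move=> u v w; apply: completion_ext => n /=.
pose T (s : nat -> R) := \poly_(i < n.+1) s i.
have T_mul (s t : nat -> R) m : (m < n.+1)%N ->
    (T s * T t)`_m = \sum_(i < m.+1) s i * t (m - i)%N.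
  move=> lt_mn; rewrite coefM; apply: eq_bigr => i _.
  rewrite !coef_poly (leq_trans (ltn_ord i)) //.
  by rewrite (leq_ltn_trans (leq_subr _ _)).
transitivity (T u * (T v * T w))`_n.
  rewrite coefM; apply: eq_bigr => i _.
  by rewrite T_mul ?ltnS ?leq_subr // coef_poly ltn_ord.
rewrite mulrA coefM; apply: eq_bigr => i _.
by rewrite T_mul // coef_poly ltnS leq_subr.
Qed.

Fact completion_mul1 : left_id (to_completion 1) completion_mul.
Proof.
move=> u; apply: completion_ext => n /=.
rewrite big_ord_recl /= gcomp1 mul1r subn0 big1 ?addr0 // => i _.
by rewrite gcomp_one mul0r.
Qed.

Fact completion_mulr1 : right_id (to_completion 1) completion_mul.
Proof.
move=> u; apply: completion_ext => n /=.
rewrite big_ord_recr /= subnn gcomp1 mulr1 big1 ?add0r // => i _.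
by rewrite gcomp_one subn_eq0 leqNgt ltn_ord mulr0.
Qed.

Fact completion_mulDl : left_distributive completion_mul +%R.
Proof.
move=> u v w; apply: completion_ext => n /=.
by rewrite -big_split; apply: eq_bigr => i _; rewrite mulrDl.
Qed.

Fact completion_mulDr : right_distributive completion_mul +%R.
Proof.
move=> u v w; apply: completion_ext => n /=.
by rewrite -big_split; apply: eq_bigr => i _; rewrite mulrDr.
Qed.

Fact completion_one_neq0 : to_completion 1 != 0.
Proof.
apply/eqP => /(congr1 (fun u : completion => u 0%N)) /=.
by rewrite gcomp1; apply/eqP; exact: oner_neq0.
Qed.

HB.instance Definition _ := GRing.Zmodule_isNzRing.Build completion
  completion_mulA completion_mul1 completion_mulr1
  completion_mulDl completion_mulDr completion_one_neq0.

Lemma to_completionB (x y : R) :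
  to_completion (x - y) = to_completion x - to_completion y.
Proof. by apply: completion_ext => n; exact: gcompB. Qed.

Fact to_completion_monoid_morphism : monoid_morphism to_completion.
Proof. by split=> [|x y]; apply: completion_ext => n //=; exact: gcompM. Qed.

HB.instance Definition _ :=
  GRing.isZmodMorphism.Build R completion to_completion to_completionB.
HB.instance Definition _ :=
  GRing.isMonoidMorphism.Build R completion to_completion
    to_completion_monoid_morphism.

Lemma to_completion_inj : injective to_completion.
Proof.
move=> x y exy; apply/eqP; rewrite -subr_eq0; apply/eqP.
have [N ->] := gcomp_fin g (x - y); apply: big1 => n _.
by rewrite gcompB [g n x](congr1 (fun u : completion => u n) exy) subrr.
Qed.

Definition completion_unit : {pred completion} :=
  [pred u | `[< exists v : completion, v * u = 1 /\ u * v = 1 >]].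

Definition completion_inv (u : completion) : completion :=
  if pselect (exists v : completion, v * u = 1 /\ u * v = 1) is left ex
  then projT1 (cid ex) else u.

Fact completion_invP (u : completion) : u \in completion_unit ->
  completion_inv u * u = 1 /\ u * completion_inv u = 1.
Proof.
rewrite inE => /asboolP ex; rewrite /completion_inv.
by case: pselect => // ex'; case: (cid ex').
Qed.

Fact completion_mulVr :
  {in completion_unit, left_inverse 1 completion_inv *%R}.
Proof. by move=> u /completion_invP[]. Qed.

Fact completion_divrr :
  {in completion_unit, right_inverse 1 completion_inv *%R}.
Proof. by move=> u /completion_invP[]. Qed.

Fact completion_unitP (u v : completion) :
  v * u = 1 /\ u * v = 1 -> completion_unit u.
Proof. by move=> h; apply/asboolP; exists v. Qed.

Fact completion_inv_out :
  {in [predC completion_unit], completion_inv =1 id}.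
Proof.
move=> u; rewrite !inE => /asboolPn nex.
by rewrite /completion_inv; case: pselect.
Qed.

HB.instance Definition _ := GRing.NzRing_hasMulInverse.Build completion
  completion_mulVr completion_divrr completion_unitP completion_inv_out.

(* \sum_n u_n = s for the product topology on \prod_n R_n, the factors being
   discrete: in each degree the partial sums are eventually equal to s. *)
Definition completion_series (u : nat -> completion) (s : completion) : Prop :=
  forall d, exists N0, forall N, (N0 <= N)%N -> (\sum_(n < N) u n) d = s d.

End GradingTheory.

Arguments completion {R} g.
Arguments to_completion {R} g x.

Section QuantumMatrixAlgebra.
Context {K : comUnitRingType} (q : K) (r : nat).

(* the free unital associative K-algebra on r * r letters *)
Definition free_mat : Type := {malg K[{fmonom ('I_r * 'I_r)%type}]}.
HB.instance Definition _ := GRing.Lalgebra.on free_mat.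

Fact free_mat_scaleAr (a : K) (x y : free_mat) : a *: (x * y) = x * (a *: y).
Proof.
have cC (u : free_mat) : u * (malgC a : free_mat) = (malgC a : free_mat) * u.
  rewrite /GRing.mul /= fgmulgU fgmulUg; apply: eq_bigr => k _.
  by rewrite mulrC mulm1 mul1m.
have mZ (u : free_mat) : a *: u = (malgC a : free_mat) * u by rewrite mul_malgC.
by rewrite !mZ mulrA -cC -mulrA.
Qed.

HB.instance Definition _ :=
  GRing.Lalgebra_isAlgebra.Build K free_mat free_mat_scaleAr.

Definition free_gen (i j : 'I_r) : free_mat := << 1 *g fmu (i, j) >>.

(* Each relation is listed as (left-hand side) - (right-hand side). *)
Definition qmat_rel (x : free_mat) : Prop :=
  exists i i' j j' : 'I_r, [/\ (i < i')%N, (j < j')%N &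
    let a := free_gen i j in let b := free_gen i j' in
    let c := free_gen i' j in let d := free_gen i' j' in
    x \in [:: b * a - q *: (a * b);
              c * a - q *: (a * c);
              d * b - q *: (b * d);
              d * c - q *: (c * d);
              c * b - b * c;
              a * d - (d * a + q^-1 *: (c * b) - q *: (b * c))]].

Definition free_comp (n : nat) (x : free_mat) : free_mat :=
  [malg w in msupp x => x@_w *+ (fdeg w == n)].

Lemma free_compE n (x : free_mat) w :
  (free_comp n x)@_w = x@_w *+ (fdeg w == n).
Proof. by rewrite /free_comp mcoeffE; case: msuppP; rewrite ?mul0rn. Qed.

Lemma free_compB n (x y : free_mat) :
  free_comp n (x - y) = free_comp n x - free_comp n y.
Proof. by apply/malgP => w; rewrite mcoeffB !free_compE mcoeffB mulrnBl. Qed.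

Lemma free_comp0 n : free_comp n 0 = 0.
Proof. by apply/malgP => w; rewrite free_compE mcoeff0 mul0rn. Qed.

Lemma free_compD n (x y : free_mat) :
  free_comp n (x + y) = free_comp n x + free_comp n y.
Proof. by apply/malgP => w; rewrite mcoeffD !free_compE mcoeffD mulrnDl. Qed.

Lemma free_compZ n k (x : free_mat) :
  free_comp n (k *: x) = k *: free_comp n x.
Proof. by apply/malgP => w; rewrite mcoeffZ !free_compE mcoeffZ mulrnAr. Qed.

Lemma free_comp_id n m (x : free_mat) :
  free_comp n (free_comp m x) = if n == m then free_comp m x else 0.
Proof.
apply/malgP => w; rewrite !free_compE -mulrnA mulnb.
case: (eqVneq n m) => [->|ne]; first by rewrite free_compE andbb.
rewrite mcoeff0; case: (eqVneq (fdeg w) m) => [->|]; last by rewrite mulr0n.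
by rewrite eq_sym (negPf ne) mulr0n.
Qed.

Lemma free_comp1 n : free_comp n 1 = (n == 0%N)%:R.
Proof.
apply/malgP => w; rewrite free_compE mcoeff1.
have [->|ne] := eqVneq w mone; last first.
  rewrite mul0rn; case: eqP => _; last by rewrite mcoeff0.
  by rewrite mcoeff1 (negPf ne).
rewrite fdeg1 eq_sym; case: eqP => _; last by rewrite mcoeff0.
by rewrite mcoeff1 eqxx.
Qed.

Lemma free_comp_supp n (x : free_mat) : (msupp (free_comp n x) `<=` msupp x)%fset.
Proof.
apply/fsubsetP => w; rewrite -!mcoeff_neq0 free_compE.
by apply: contraNneq => ->; rewrite mul0rn.
Qed.

Lemma free_mcoeffM (D E : {fset {fmonom ('I_r * 'I_r)%type}}) (x y : free_mat) w :
  (msupp x `<=` D)%fset -> (msupp y `<=` E)%fset ->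
  (x * y)@_w = \sum_(u <- D) \sum_(v <- E) (x@_u * y@_v) *+ (mmul u v == w).
Proof. exact: mcoeffMlw. Qed.

Lemma free_compM n (x y : free_mat) : free_comp n (x * y) =
  \sum_(i < n.+1) free_comp i x * free_comp (n - i) y.
Proof.
apply/malgP => w; rewrite free_compE (free_mcoeffM w (fsubset_refl (msupp x)) (fsubset_refl (msupp y))).
rewrite [RHS](raddf_sum (mcoeff w)) /=.
under [RHS]eq_bigr => i _ do
  rewrite (free_mcoeffM _ (free_comp_supp i x) (free_comp_supp (n - i) y)).
rewrite [RHS]exchange_big -sumrMnl; apply: eq_bigr => u _ /=.
rewrite [RHS]exchange_big -sumrMnl; apply: eq_bigr => v _ /=.
have [<-{w}|] := eqVneq (mmul u v) w; last first.
  by move=> _; rewrite mulr0n mul0rn big1.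
under eq_bigr => i _ do rewrite mulr1n !free_compE mulrnAl mulrnAr -mulrnA mulnb.
rewrite mulr1n fdegM; case: (leqP (fdeg u) n) => [le_un|lt_nu].
  have ltu : (fdeg u < n.+1)%N by rewrite ltnS.
  rewrite (bigD1 (Ordinal ltu)) //= eqxx big1 ?addr0 => [|i ne].
    by rewrite andbT -(eqn_add2l (fdeg u) _ (n - _)) subnKC.
  suff -> : (fdeg u == i) = false by rewrite andbF.
  by rewrite eq_sym; exact: (negPf ne).
rewrite big1 => [|i _].
  by rewrite gtn_eqF ?mulr0n // (leq_trans lt_nu) ?leq_addr.
by rewrite [fdeg u == i]gtn_eqF ?andbF // (leq_ltn_trans _ lt_nu) // -ltnS.
Qed.

Lemma free_comp_fin (x : free_mat) : exists N, x = \sum_(n < N) free_comp n x.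
Proof.
exists (\max_(w <- msupp x) (fdeg w).+1)%N.
apply/malgP => w; rewrite raddf_sum /=.
under eq_bigr do rewrite free_compE.
have [wx|/mcoeff_outdom ->] := boolP (w \in msupp x); last first.
  by rewrite big1 // => i _; rewrite mul0rn.
have ltw : (fdeg w < \max_(w <- msupp x) (fdeg w).+1)%N.
  by rewrite (big_rem w) //= leq_max leqnn.
rewrite (bigD1 (Ordinal ltw)) //= eqxx big1 ?addr0 // => i ne.
by rewrite eq_sym (negPf (ne : i != _ :> nat)).
Qed.

Lemma qmat_rel_deg (x : free_mat) n : qmat_rel x ->
  free_comp n x = if n == 2%N then x else 0.
Proof.
pose H (x : free_mat) := free_comp n x = if n == 2%N then x else 0.
have hB (y z : free_mat) : H y -> H z -> H (y - z).
  by rewrite /H free_compB => -> ->; case: ifP; rewrite ?subr0.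
have hD (y z : free_mat) : H y -> H z -> H (y + z).
  by rewrite /H free_compD => -> ->; case: ifP; rewrite ?addr0.
have hZ k (y : free_mat) : H y -> H (k *: y).
  by rewrite /H free_compZ => ->; case: ifP; rewrite ?scaler0.
have hM a b c d : H (free_gen a b * free_gen c d).
  apply/malgP => w; rewrite /free_gen malgM_def fgmulUU free_compE mcoeffU.
  have [<-|ne] := eqVneq _ w; last first.
    by rewrite mul0rn; case: ifP => _; rewrite ?mcoeff0 // mcoeffU (negPf ne).
  rewrite fdegM !fdegU eq_sym; case: ifP => _; last by rewrite mcoeff0.
  by rewrite mcoeffUU mulr1 !mulr1n.
rewrite -/(H x) => -[i] [i'] [j] [j'] [_ _ /=].
rewrite !inE => /or4P[| | |/or3P[]] /eqP->; (apply: (hB); first exact: hM).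
- by apply: (hZ); exact: hM.
- by apply: (hZ); exact: hM.
- by apply: (hZ); exact: hM.
- by apply: (hZ); exact: hM.
- exact: hM.
- apply: (hB); last by apply: (hZ); exact: hM.
  by apply: (hD); [exact: hM | apply: (hZ); exact: hM].
Qed.

Lemma qmat_ideal_comp n (x : free_mat) :
  ideal_gen qmat_rel x -> ideal_gen qmat_rel (free_comp n x).
Proof.
move=> xI; elim: xI n => {x} [x xr||x y _ IHx _ IHy|u x _ IHx|x u _ IHx] n.
- rewrite qmat_rel_deg //; case: eqP => _; last exact: ideal_gen0.
  exact: ideal_gen_rel.
- by rewrite free_comp0; exact: ideal_gen0.
- by rewrite free_compB; apply: ideal_genB.
- rewrite free_compM; elim/big_ind: _ => [||i _]; first exact: ideal_gen0.
    exact: ideal_genD.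
  by apply: ideal_genMl.
- rewrite free_compM; elim/big_ind: _ => [||i _]; first exact: ideal_gen0.
    exact: ideal_genD.
  by apply: ideal_genMr.
Qed.

Fact qmat_proper : ~ ideal_gen qmat_rel 1.
Proof.
have H (x : free_mat) : ideal_gen qmat_rel x -> free_comp 0 x = 0.
  elim=> {x} [x xr||x y _ IHx _ IHy|u x _ IHx|x u _ IHx].
  - by rewrite qmat_rel_deg.
  - exact: free_comp0.
  - by rewrite free_compB IHx IHy subr0.
  - by rewrite free_compM big_ord_recl big_ord0 IHx mulr0 addr0.
  - by rewrite free_compM big_ord_recl big_ord0 IHx mul0r addr0.
by move=> /H /eqP; rewrite free_comp1 eqxx oner_eq0.
Qed.

Definition qmat : Type := alg_quot qmat_proper.
HB.instance Definition _ := GRing.Algebra.on qmat.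

Lemma qmat_surj (x : qmat) : exists y : free_mat, x = alg_pi qmat_proper y.
Proof. exact: alg_pi_surj. Qed.

Definition qmat_gen : 'M[qmat]_r :=
  \matrix_(i, j) alg_pi qmat_proper (free_gen i j).

Lemma qmat_genP (i i' j j' : 'I_r) : (i < i')%N -> (j < j')%N ->
  let a := qmat_gen i j in let b := qmat_gen i j' in
  let c := qmat_gen i' j in let d := qmat_gen i' j' in
  [/\ b * a = q *: (a * b), c * a = q *: (a * c),
      d * b = q *: (b * d) & d * c = q *: (c * d)] /\
  (c * b = b * c /\ a * d = d * a + q^-1 *: (c * b) - q *: (b * c)).
Proof.
move=> lti ltj /=; rewrite !mxE.
pose a := free_gen i j; pose b := free_gen i j'.
pose c := free_gen i' j; pose d := free_gen i' j'.
pose rels := [:: b * a - q *: (a * b); c * a - q *: (a * c);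
  d * b - q *: (b * d); d * c - q *: (c * d); c * b - b * c;
  a * d - (d * a + q^-1 *: (c * b) - q *: (b * c))].
have rel k (x y : free_mat) : (k < 6)%N -> x - y = nth 0 rels k ->
    alg_pi qmat_proper x = alg_pi qmat_proper y.
  move=> lek xyE; apply/alg_piP; apply: ideal_gen_rel.
  exists i, i', j, j'; split=> //; change (x - y \in rels).
  by rewrite xyE mem_nth.
have relq k (x y z t : free_mat) :
    (k < 6)%N -> x * y - q *: (z * t) = nth 0 rels k ->
    alg_pi qmat_proper x * alg_pi qmat_proper y =
    q *: (alg_pi qmat_proper z * alg_pi qmat_proper t).
  by move=> lek xyE; rewrite -!alg_piM -alg_piZ; exact: rel xyE.
split; first split.
- exact: (relq 0%N).
- exact: (relq 1%N).
- exact: (relq 2%N).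
- exact: (relq 3%N).
split; first by rewrite -!alg_piM; exact: (rel 4%N).
by rewrite -!alg_piM -!alg_piZ -alg_piD -alg_piB; exact: (rel 5%N).
Qed.

Definition qmat_comp (n : nat) (x : qmat) : qmat :=
  alg_pi qmat_proper (free_comp n (alg_repr (x : alg_quot qmat_proper))).

Lemma qmat_compE n (x : free_mat) :
  qmat_comp n (alg_pi qmat_proper x) = alg_pi qmat_proper (free_comp n x).
Proof.
apply/alg_piP; rewrite -free_compB; apply: qmat_ideal_comp.
exact: ideal_gen_repr.
Qed.

Fact qmat_compB n (x y : qmat) :
  qmat_comp n (x - y) = qmat_comp n x - qmat_comp n y.
Proof.
have [x' ->] := qmat_surj x; have [y' ->] := qmat_surj y.
by rewrite -alg_piB !qmat_compE free_compB alg_piB.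
Qed.

Fact qmat_comp_id n m (x : qmat) :
  qmat_comp n (qmat_comp m x) = if n == m then qmat_comp m x else 0.
Proof.
have [x' ->] := qmat_surj x; rewrite !qmat_compE free_comp_id.
by case: eqP => // _; exact: alg_pi0.
Qed.

Fact qmat_comp_fin (x : qmat) : exists N, x = \sum_(n < N) qmat_comp n x.
Proof.
have [x' ->] := qmat_surj x; have [N {1}->] := free_comp_fin x'.
exists N; rewrite raddf_sum; apply: eq_bigr => n _; exact: esym (qmat_compE _ _).
Qed.

Fact qmat_comp1 : qmat_comp 0 1 = 1.
Proof. by rewrite -(alg_pi1 qmat_proper) qmat_compE free_comp1. Qed.

Fact qmat_compM n (x y : qmat) :
  qmat_comp n (x * y) = \sum_(i < n.+1) qmat_comp i x * qmat_comp (n - i) y.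
Proof.
have [x' ->] := qmat_surj x; have [y' ->] := qmat_surj y.
rewrite -alg_piM qmat_compE free_compM raddf_sum; apply: eq_bigr => i _.
by rewrite !qmat_compE -alg_piM.
Qed.

Definition qmat_grading : grading qmat :=
  Grading qmat_compB qmat_comp_id qmat_comp_fin qmat_comp1 qmat_compM.

Lemma qmat_gen_homog i j : qmat_gen i j \in homog qmat_grading 1.
Proof.
rewrite inE mxE /= qmat_compE; apply/eqP; congr alg_pi.
apply/malgP => w; rewrite free_compE mcoeffU.
by have [<-|_] := eqVneq _ w; rewrite ?fdegU ?mul0rn.
Qed.

End QuantumMatrixAlgebra.

Arguments qmat {K} q r.
Arguments qmat_gen {K} q r.
Arguments qmat_grading {K} q r.

Section QuantumDeterminant.
Context {K : comUnitRingType} (q : K) {M : algType K}.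

Definition perm_inv n (s : 'S_n) : nat :=
  #|[set p : 'I_n * 'I_n | (p.1 < p.2)%N && (s p.2 < s p.1)%N]|.

Definition qdet n (B : 'M[M]_n) : M :=
  \sum_(s : 'S_n) (- q) ^- perm_inv s *: \prod_(i < n) B (s i) i.

(* enum_val lists the elements of J in increasing order. *)
Definition principal_submx r (A : 'M[M]_r) (J : {set 'I_r}) : 'M[M]_#|J| :=
  mxsub (@enum_val _ (mem J)) (@enum_val _ (mem J)) A.

Definition Ferm r (A : 'M[M]_r) : M :=
  \sum_(J : {set 'I_r}) (-1) ^+ #|J| * qdet (principal_submx A J).

End QuantumDeterminant.

Definition xmon (r : nat) := {ffun 'I_r -> nat}.
Definition xmon1 r : xmon r := [ffun => 0%N].
Definition xmonU r (j : 'I_r) : xmon r := [ffun i => (i == j) : nat].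
Definition xmonD r (m n : xmon r) : xmon r := [ffun i => (m i + n i)%N].
Definition xmon_inv r (m n : xmon r) : nat :=
  (\sum_(p : 'I_r * 'I_r | p.1 < p.2) m p.2 * n p.1)%N.

(* The algebra over M generated by x_1, ..., x_r commuting with M and subject to
   x_j x_i = q x_i x_j (i < j), as the free left M-module on the ordered
   monomials x^m = x_1^{m_1} ... x_r^{m_r}.  Sorting the letters gives
   x^m x^n = q^(\sum_{i < j} m_j n_i) x^(m + n). *)
Definition qspace (K : comUnitRingType) (q : K) (M : algType K) (r : nat) :
  Type := {malg M[xmon r]}.

Definition qspace_mon (K : comUnitRingType) (q : K) (M : algType K) (r : nat)
  (a : M) (m : xmon r) : qspace q M r := << a *g m >>.

HB.instance Definition _ (K : comUnitRingType) (q : K) (M : algType K) r :=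
  GRing.Zmodule.on (qspace q M r).
HB.instance Definition _ (K : comUnitRingType) (q : K) (M : algType K) r :=
  GRing.Lmodule.on (qspace q M r).

HB.lock Definition qspace_mul (K : comUnitRingType) (q : K) (M : algType K)
    (r : nat) (f g : qspace q M r) : qspace q M r :=
  \sum_(m <- msupp f) \sum_(n <- msupp g)
    qspace_mon q (q ^+ xmon_inv m n *: (f@_m * g@_n)) (xmonD m n).

Section QuantumSpace.
Context {K : comUnitRingType} (q : K) (M : algType K) (r : nat).
Local Notation S := (qspace q M r).
Local Notation mon := (@qspace_mon K q M r).
Local Notation mul := (@qspace_mul K q M r).

Definition qspace_one : S := mon 1 (xmon1 r).

Lemma xmonDA : associative (@xmonD r).
Proof. by move=> m n p; apply/ffunP => i; rewrite !ffunE addnA. Qed.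

Lemma xmonDC : commutative (@xmonD r).
Proof. by move=> m n; apply/ffunP => i; rewrite !ffunE addnC. Qed.

Lemma xmon1D : left_id (xmon1 r) (@xmonD r).
Proof. by move=> m; apply/ffunP => i; rewrite !ffunE. Qed.

Lemma xmonD1 : right_id (xmon1 r) (@xmonD r).
Proof. by move=> m; rewrite xmonDC xmon1D. Qed.

Lemma xmon_inv1m (m : xmon r) : xmon_inv (xmon1 r) m = 0%N.
Proof. by apply: big1 => p _; rewrite ffunE. Qed.

Lemma xmon_invm1 (m : xmon r) : xmon_inv m (xmon1 r) = 0%N.
Proof. by apply: big1 => p _; rewrite ffunE muln0. Qed.

Lemma xmon_invDl (m n p : xmon r) :
  xmon_inv (xmonD m n) p = (xmon_inv m p + xmon_inv n p)%N.
Proof.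
by rewrite -big_split; apply: eq_bigr => i _; rewrite ffunE mulnDl.
Qed.

Lemma xmon_invDr (m n p : xmon r) :
  xmon_inv m (xmonD n p) = (xmon_inv m n + xmon_inv m p)%N.
Proof.
by rewrite -big_split; apply: eq_bigr => i _; rewrite ffunE mulnDr.
Qed.

Lemma xmon_invU (i j : 'I_r) : xmon_inv (xmonU j) (xmonU i) = (i < j)%N.
Proof.
rewrite /xmon_inv; case: ltnP => [lt_ij|le_ji].
  rewrite (bigD1 (i, j)) //= !ffunE !eqxx big1 // => -[a b] /= /andP[_ ne].
  rewrite !ffunE mulnb; case: eqP => // bj; case: eqP => // ai.
  by rewrite ai bj eqxx in ne.
apply: big1 => -[a b] /= lt_ab; rewrite !ffunE mulnb.
case: eqP => // bj; case: eqP => // ai.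
by rewrite ai bj ltnNge le_ji in lt_ab.
Qed.

Lemma qspace_monD (a b : M) m : mon (a + b) m = mon a m + mon b m.
Proof. exact: monalgUD. Qed.

Lemma qspace_mon0 m : mon 0 m = 0.
Proof. exact: monalgU0. Qed.

Lemma qspaceE (f : S) : f = \sum_(m <- msupp f) mon f@_m m.
Proof. exact: monalgE. Qed.

Lemma qspace_mulw (D E : {fset xmon r}) (f g : S) :
  (msupp f `<=` D)%fset -> (msupp g `<=` E)%fset ->
  mul f g = \sum_(m <- D) \sum_(n <- E)
    mon (q ^+ xmon_inv m n *: (f@_m * g@_n)) (xmonD m n).
Proof.
move=> leD leE; rewrite qspace_mul.unlock (big_fset_incl _ leD) /=.
  apply/eq_bigr => m _; apply/big_fset_incl => // n _ /mcoeff_outdom ->.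
  by rewrite mulr0 scaler0 qspace_mon0.
move=> m _ /mcoeff_outdom fm.
by rewrite big1 // => n _; rewrite fm mul0r scaler0 qspace_mon0.
Qed.

Lemma qspace_mulU (a b : M) m n :
  mul (mon a m) (mon b n) = mon (q ^+ xmon_inv m n *: (a * b)) (xmonD m n).
Proof.
by rewrite (qspace_mulw msuppU_le msuppU_le) !big_seq_fset1 !mcoeffUU.
Qed.

Fact qspace_mulDl : left_distributive mul +%R.
Proof.
move=> f g h; have le := fsubset_refl (msupp h).
rewrite (qspace_mulw (msuppD_le f g) le).
rewrite (qspace_mulw (fsubsetUl (msupp f) (msupp g)) le).
rewrite (qspace_mulw (fsubsetUr (msupp f) (msupp g)) le).
rewrite -big_split /=; apply/eq_bigr => m _.
rewrite -big_split /=; apply/eq_bigr => n _.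
by rewrite mcoeffD mulrDl scalerDr qspace_monD.
Qed.

Fact qspace_mulDr : right_distributive mul +%R.
Proof.
move=> h f g; have le := fsubset_refl (msupp h).
rewrite (qspace_mulw le (msuppD_le f g)).
rewrite (qspace_mulw le (fsubsetUl (msupp f) (msupp g))).
rewrite (qspace_mulw le (fsubsetUr (msupp f) (msupp g))).
rewrite -big_split /=; apply/eq_bigr => m _.
rewrite -big_split /=; apply/eq_bigr => n _.
by rewrite mcoeffD mulrDr scalerDr qspace_monD.
Qed.

Fact qspace_mul0l : left_zero 0 mul.
Proof. by move=> f; rewrite qspace_mul.unlock msupp0 big_seq_fset0. Qed.

Fact qspace_mul0r : right_zero 0 mul.
Proof.
move=> f; rewrite qspace_mul.unlock; apply: big1 => m _.
by rewrite msupp0 big_seq_fset0.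
Qed.

Let mul_suml (I : Type) (s : seq I) (F : I -> S) (g : S) :
  mul (\sum_(i <- s) F i) g = \sum_(i <- s) mul (F i) g.
Proof.
exact: (big_morph (mul^~ g) (fun x y => qspace_mulDl x y g) (qspace_mul0l g)).
Qed.

Let mul_sumr (I : Type) (s : seq I) (F : I -> S) (g : S) :
  mul g (\sum_(i <- s) F i) = \sum_(i <- s) mul g (F i).
Proof.
exact: (big_morph (mul g) (fun x y => qspace_mulDr g x y) (qspace_mul0r g)).
Qed.

Fact qspace_mulA : associative mul.
Proof.
move=> f g h; rewrite [f]qspaceE !mul_suml; apply: eq_bigr => m _.
rewrite [g]qspaceE !(mul_suml, mul_sumr); apply: eq_bigr => n _.
rewrite [h]qspaceE !mul_sumr; apply: eq_bigr => p _.
rewrite !qspace_mulU xmonDA xmon_invDl xmon_invDr; congr mon.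
rewrite -scalerAr -scalerAl !scalerA mulrA -!exprD; congr (_ ^+ _ *: _).
by rewrite addnC addnA addnC addnA.
Qed.

Fact qspace_mul1 : left_id qspace_one mul.
Proof.
move=> f; rewrite [f]qspaceE mul_sumr; apply: eq_bigr => m _.
by rewrite qspace_mulU xmon1D xmon_inv1m expr0 scale1r mul1r.
Qed.

Fact qspace_mulr1 : right_id qspace_one mul.
Proof.
move=> f; rewrite [f]qspaceE mul_suml; apply: eq_bigr => m _.
by rewrite qspace_mulU xmonD1 xmon_invm1 expr0 scale1r mulr1.
Qed.

Fact qspace_one_neq0 : qspace_one != 0.
Proof. by rewrite monalgU_eq0 oner_eq0. Qed.

HB.instance Definition _ := GRing.Zmodule_isNzRing.Build S
  qspace_mulA qspace_mul1 qspace_mulr1 qspace_mulDl qspace_mulDr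
  qspace_one_neq0.

Lemma qspace_monM (a b : M) m n :
  mon a m * mon b n = mon (q ^+ xmon_inv m n *: (a * b)) (xmonD m n).
Proof. exact: qspace_mulU. Qed.

Lemma qspace_scale_mon (a b : M) m : a *: mon b m = mon (a * b) m.
Proof. by apply/malgP => n; rewrite mcoeffZ !mcoeffU mulrnAr. Qed.

Fact qspace_scaleAl (a : M) (f g : S) : a *: (f * g) = (a *: f) * g.
Proof.
rewrite [f]qspaceE [g]qspaceE scaler_sumr !mulr_suml scaler_sumr.
apply: eq_bigr => m _; rewrite !mulr_sumr scaler_sumr; apply: eq_bigr => n _.
by rewrite !(qspace_monM, qspace_scale_mon) -scalerAr mulrA.
Qed.

HB.instance Definition _ := GRing.Lmodule_isLalgebra.Build M S qspace_scaleAl.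

Definition qspace_x (j : 'I_r) : S := mon 1 (xmonU j).

Lemma qspace_xC (i j : 'I_r) : (i < j)%N ->
  qspace_x j * qspace_x i = (q%:A : M) *: (qspace_x i * qspace_x j).
Proof.
move=> lt_ij; rewrite !qspace_monM qspace_scale_mon !xmon_invU lt_ij.
rewrite ltnNge ltnW //= expr1 expr0 scale1r mulr1 xmonDC.
by rewrite mulr1.
Qed.

Lemma qspace_x_coefC (a : M) j : qspace_x j * a%:A = a *: qspace_x j.
Proof.
have -> : a%:A = mon a (xmon1 r) by rewrite qspace_scale_mon mulr1.
rewrite qspace_scale_mon qspace_monM xmonD1.
by rewrite xmon_invm1 expr0 scale1r mul1r mulr1.
Qed.

Lemma qspace_xX (j : 'I_r) k :
  qspace_x j ^+ k = mon 1 [ffun i => (if i == j then k else 0)%N].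
Proof.
elim: k => [|k IHk].
  by rewrite expr0; congr mon; apply/ffunP => i; rewrite !ffunE if_same.
rewrite exprSr IHk qspace_monM mulr1 (_ : xmon_inv _ _ = 0%N).
  rewrite expr0 scale1r; congr mon; apply/ffunP => i; rewrite !ffunE.
  by case: eqP; rewrite ?addn1.
apply: big1 => -[a b] /= lt_ab; rewrite !ffunE.
case: eqP => [bj|]; last by rewrite mul0n.
case: eqP => [aj|]; last by rewrite muln0.
by rewrite aj bj ltnn in lt_ab.
Qed.

Lemma qspace_xmonE (m : xmon r) : \prod_(j < r) qspace_x j ^+ m j = mon 1 m.
Proof.
pose F k : S := if insub k is Some j then qspace_x j ^+ m j else 1.
have FE (j : 'I_r) : F j = qspace_x j ^+ m j by rewrite /F valK.
rewrite (eq_bigr (fun j : 'I_r => F j)) => [|j _]; last by rewrite FE.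
rewrite -(big_mkord xpredT F).
suff H k : (k <= r)%N -> \prod_(0 <= i < k) F i =
    mon 1 [ffun i : 'I_r => (if i < k then m i else 0)%N].
  rewrite H //; congr mon; apply/ffunP => i; by rewrite ffunE ltn_ord.
elim: k => [_|k IHk lt_kr].
  by rewrite big_geq //; congr mon; apply/ffunP => i; rewrite !ffunE.
rewrite big_nat_recr //= IHk 1?ltnW // (FE (Ordinal lt_kr)) qspace_xX.
rewrite qspace_monM mulr1 (_ : xmon_inv _ _ = 0%N).
  rewrite expr0 scale1r; congr mon; apply/ffunP => i; rewrite !ffunE ltnS.
  rewrite -[i == _]/(i == k :> nat) [(i <= k)%N]leq_eqVlt.
  have [ik|ik|ik] := ltngtP (i : nat) k; rewrite /= ?addn0 ?add0n //.
  by congr (m _); apply: val_inj.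
apply: big1 => -[a b] /= lt_ab; rewrite !ffunE.
case: ltnP => [lt_bk|]; last by rewrite mul0n.
case: eqP => [ak|]; last by rewrite muln0.
by move: (ltn_trans lt_ab lt_bk); rewrite ak ltnn.
Qed.

Definition deg_xmon (n : nat) : Type :=
  {m : {ffun 'I_r -> 'I_n.+1} | (\sum_i m i == n)%N}.
HB.instance Definition _ n := Finite.on (deg_xmon n).

Definition xmon_of n (m : deg_xmon n) : xmon r := [ffun i => val m i : nat].

Definition qspace_X (A : 'M[M]_r) (i : 'I_r) : S :=
  \sum_(j < r) A i j *: qspace_x j.

Definition qspace_Xmon (A : 'M[M]_r) (m : xmon r) : S :=
  \prod_(i < r) qspace_X A i ^+ m i.

(* The matrix of S^n(A), x^m |-> X^m, in the basis of ordered monomials. *)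
Definition qsym (n : nat) (A : 'M[M]_r) : 'M[M]_#|{: deg_xmon n}| :=
  \matrix_(k, l) (qspace_Xmon A (xmon_of (enum_val k)))@_(xmon_of (enum_val l)).

Lemma tr_qsym n (A : 'M[M]_r) :
  \tr (qsym n A) =
  \sum_(m : deg_xmon n) (qspace_Xmon A (xmon_of m))@_(xmon_of m).
Proof.
rewrite [RHS](reindex_onto enum_val enum_rank) => [|m _]; last exact: enum_rankK.
by apply: eq_big => [k|k _]; rewrite ?enum_valK ?eqxx // mxE.
Qed.

End QuantumSpace.

(* Main.v *)
Require Import Defs.
From mathcomp Require Import all_boot all_order all_algebra.
From mathcomp Require Import fingroup perm finmap ring.
From mathcomp.multinomials Require Import monalg.

(* The argument only uses that A is right-quantum.  Put Xi_j = \sum_i a_ij xi_i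
   in the quantum exterior algebra, where xi_j xi_i = - q^-1 xi_i xi_j for
   i < j; then Xi_J = \sum_P D_PJ xi_P, the D_PJ being the quantum minors, and
   X^m = \sum_u G_mu x^u.  Evaluating Xi_J * (\sum_j Xi_j x_j) * X^m =
   Xi_J * (\sum_i xi_i X_i) * X^m in two ways shows that the matrix D \otimes G
   commutes with the differential of the Koszul complex \Lambda \otimes S, whose
   entries are scalars.  In degree n > 0 this complex has a scalar contracting
   homotopy, so the alternating sum of the traces of D \otimes G vanishes:
   \sum_J (-1)^|J| D_JJ tr S^(n - |J|)(A) = 0, i.e. Ferm(A) \sum_n tr S^n(A) = 1.
   A right inverse of a series with constant term 1 is also a left inverse. *)

Set Implicit Arguments.
Unset Strict Implicit.
Unset Printing Implicit Defensive.

Import GRing.Theory.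
Local Open Scope ring_scope.

(** * Alternating traces and contracting homotopies *)

Section TraceHomotopy.
Context {K : comNzRingType} {R : algType K} {I : eqType} (s : seq I).

(* With entries of [d] and [h] central, tr (e M d h) = tr (e d M h), which is
   - tr (d e M h) = - tr (e M h d) since [d] anticommutes with the sign [e]. *)
Lemma alternating_trace_eq0 (M : I -> I -> R) (d h : I -> I -> K) (e : I -> K) :
  uniq s ->
  {in s &, forall x y,
    \sum_(z <- s) d z y *: M x z = \sum_(z <- s) d x z *: M z y} ->
  {in s &, forall x y,
    \sum_(z <- s) h x z * d z y + \sum_(z <- s) d x z * h z y = (x == y)%:R} ->
  (forall x y, d x y * e y = - (d x y * e x)) ->
  \sum_(x <- s) e x *: M x x = 0.
Proof.
move=> us Md hd de.
(* [T f] is tr (e M f). *)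
pose T (f : I -> I -> K) := \sum_(x <- s) \sum_(w <- s) (e x * f w x) *: M x w.
have -> : \sum_(x <- s) e x *: M x x = T (fun x y => (x == y)%:R).
  rewrite [LHS]big_seq [RHS]big_seq; apply: eq_bigr => x xs.
  rewrite (bigD1_seq x) //= eqxx mulr1 big1 ?addr0 // => w /negPf ->.
  by rewrite mulr0 scale0r.
have -> : T (fun x y => (x == y)%:R) =
    T (fun x y => \sum_(z <- s) h x z * d z y) +
    T (fun x y => \sum_(z <- s) d x z * h z y).
  rewrite -big_split /=; rewrite [LHS]big_seq [RHS]big_seq; apply: eq_bigr => x xs.
  rewrite -big_split /=; rewrite [LHS]big_seq [RHS]big_seq; apply: eq_bigr => w ws.
  by rewrite -scalerDl -mulrDr hd.
apply/eqP; rewrite addr_eq0; apply/eqP.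
have -> : T (fun x y => \sum_(z <- s) d x z * h z y) =
    \sum_(x <- s) \sum_(z <- s) (e x * h z x) *: \sum_(w <- s) d x w *: M w z.
  rewrite /T [LHS]big_seq [RHS]big_seq; apply: eq_bigr => x xs.
  under eq_bigr => w _ do rewrite mulr_sumr scaler_suml.
  rewrite exchange_big [LHS]big_seq [RHS]big_seq; apply: eq_bigr => z zs /=.
  rewrite -Md // scaler_sumr; apply: eq_bigr => w _.
  by rewrite scalerA -!mulrA [d w z * _]mulrC.
rewrite -sumrN; under [RHS]eq_bigr do under eq_bigr do rewrite scaler_sumr.
under [RHS]eq_bigr do rewrite exchange_big -sumrN /=.
rewrite exchange_big; apply: eq_bigr => w _ /=.
under [RHS]eq_bigr do rewrite -sumrN.
rewrite exchange_big; apply: eq_bigr => z _ /=.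
rewrite mulr_sumr scaler_suml; apply: eq_bigr => x _.
rewrite scalerA -scaleNr; congr (_ *: _).
by rewrite mulrCA [e w * _]mulrC de mulrN [e x * _]mulrC -mulrA [e x * _]mulrC.
Qed.
End TraceHomotopy.

(** * Laplace expansion along the last column *)

Section LaplaceLastColumn.

Lemma sum_leq_ord n k : (k <= n)%N -> (\sum_(i < n) (k <= i) = n - k)%N.
Proof.
move=> le_kn; rewrite -(big_mkord xpredT (fun i => (k <= i)%N : nat)).
rewrite (@big_cat_nat _ _ _ k) //= big_nat big1 => [|i /andP[_ lt_ik]].
  rewrite add0n big_nat (eq_bigr (fun => 1%N)) => [|i /andP[-> _]] //.
  by rewrite -big_nat sum_nat_const_nat muln1.
by rewrite leqNgt lt_ik.
Qed.

Lemma perm_invE n (s : 'S_n) :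
  Defs.perm_inv s = (\sum_(i < n) \sum_(j < n) ((i < j) && (s j < s i)))%N.
Proof.
rewrite /Defs.perm_inv -sum1dep_card big_mkcond pair_bigA /=.
by apply: eq_bigr => p _; case: ifP.
Qed.

Lemma ltn_lift n (k : 'I_n.+1) (i j : 'I_n) : (lift k i < lift k j)%N = (i < j)%N.
Proof. by rewrite /= !ltnNge leq_bump2. Qed.

(** As [lift k] is increasing, pairs of earlier positions are inverted as in s; the last position is
    inverted with the n - k positions whose value exceeds k. *)
Lemma perm_inv_lift_max n (k : 'I_n.+1) (s : 'S_n) :
  Defs.perm_inv (lift_perm ord_max k s) = (Defs.perm_inv s + (n - k))%N.
Proof.
have wE (i : 'I_n) : widen_ord (leqnSn n) i = lift ord_max i.
  by apply: ord_inj; rewrite lift_max.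
rewrite !perm_invE big_ord_recr /= [X in (_ + X)%N]big1 ?addn0 => [|j _]; last first.
  by rewrite ltnNge -ltnS ltn_ord.
under eq_bigr => i _ do rewrite big_ord_recr /= wE lift_perm_lift lift_perm_id ltn_ord /=.
rewrite big_split /=; congr (_ + _)%N.
  apply: eq_bigr => i _; apply: eq_bigr => j _.
  by rewrite wE lift_perm_lift; congr ((_ && _) : nat); exact: ltn_lift.
have le_kn : (k <= n)%N by rewrite -ltnS.
rewrite -(sum_leq_ord le_kn) [RHS](reindex_inj (@perm_inj _ s)) /=.
apply: eq_bigr => i _; congr ((_ : bool) : nat).
rewrite /bump; case: (leqP k (s i)) => [le|lt]; first by rewrite add1n ltnS.
by rewrite add0n ltnNge ltnW.
Qed.

Lemma lift_perm_max_bij n :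
  bijective (fun p : 'I_n.+1 * 'S_n => lift_perm ord_max p.1 p.2).
Proof.
apply: inj_card_bij => [[k s] [k' s'] /= /permP eq_ks|].
  have := eq_ks ord_max; rewrite !lift_perm_id => ekk'; rewrite -{}ekk' in eq_ks *.
  congr (_, _); apply/permP => i; have := eq_ks (lift ord_max i).
  by rewrite !lift_perm_lift; exact: lift_inj.
by rewrite card_prod card_ord !card_Sn factS.
Qed.

Context {K : comUnitRingType} (q : K) {M : algType K}.

(** Permutations are grouped by the image k of the last column, whose factor already stands last in
    each product, so no entries have to be commuted. *)
Lemma qdet_expand_last n (B : 'M[M]_n.+1) :
  qdet q B = \sum_(k < n.+1) (- q) ^- (n - k) *:
    (qdet q (mxsub (lift k) (lift ord_max) B) * B k ord_max).
Proof.
rewrite /qdet (reindex _ (onW_bij _ (lift_perm_max_bij n))) /=.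
rewrite -(pair_bigA _ (fun k s => (- q) ^- Defs.perm_inv (lift_perm ord_max k s) *:
  \prod_(i < n.+1) B (lift_perm ord_max k s i) i)) /=.
apply: eq_bigr => k _; rewrite mulr_suml scaler_sumr; apply: eq_bigr => s _.
rewrite perm_inv_lift_max -scalerAl scalerA; congr (_ *: _).
  by rewrite -!exprVn -exprD addnC.
rewrite big_ord_recr /= lift_perm_id; congr (_ * _); apply: eq_bigr => i _.
have -> : widen_ord (leqnSn n) i = lift ord_max i by apply: ord_inj; rewrite lift_max.
by rewrite lift_perm_lift mxE.
Qed.

End LaplaceLastColumn.

(** The relations under which the Xi_j satisfy those of the exterior algebra ([ext_mul_col_sq],
    [ext_mul_colC]) and the X_i those of the quantum space ([qspace_XC]). *)
Definition right_quantum (K : comUnitRingType) (q : K) (M : algType K) r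
    (A : 'M[M]_r) : Prop :=
  (forall i i' j : 'I_r, (i < i')%N -> A i' j * A i j = q *: (A i j * A i' j)) /\
  (forall i i' j j' : 'I_r, (i < i')%N -> (j < j')%N ->
    A i j * A i' j' =
    A i' j' * A i j + q^-1 *: (A i' j * A i j') - q *: (A i j' * A i' j)).

(** * Quantum minors *)

Section ExteriorMultiplication.
Context {K : comUnitRingType} (q : K) {M : algType K} {r : nat}.
Implicit Types (P J : {set 'I_r}) (i j k l : 'I_r).

Definition gt_count P i : nat := #|[set l in P | (i < l)%N]|.
(** For i in P, xi_(P \ i) xi_i = [qsign P i] xi_P: xi_i passes each larger letter at the cost of -
    q^-1. *)
Definition qsign P i : K := (- q) ^- gt_count P i.

Lemma gt_countD1 P k l :
  gt_count P l = (gt_count (P :\ k) l + ((k \in P) && (l < k)))%N.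
Proof.
rewrite /gt_count (cardsD1 k) inE addnC; congr (_ + _)%N; apply: eq_card => i.
by rewrite !inE andbA.
Qed.

Lemma gt_countD1_le P k l : (k <= l)%N -> gt_count (P :\ k) l = gt_count P l.
Proof. by move=> le_kl; rewrite (gt_countD1 P k l) ltnNge le_kl andbF addn0. Qed.

Lemma gt_countD1_gt P k l : k \in P -> (l < k)%N ->
  gt_count P l = (gt_count (P :\ k) l).+1.
Proof. by move=> kP lt_lk; rewrite (gt_countD1 P k l) kP lt_lk addn1. Qed.

Lemma gt_countU1 P i : gt_count (i |: P) i = gt_count P i.
Proof.
have [iP|iP] := boolP (i \in P); last by rewrite -(gt_countD1_le (i |: P) (leqnn i)) setU1K.
by congr gt_count; apply/setUidPr; rewrite sub1set.
Qed.

Hypothesis hq : q \is a GRing.unit.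

Let qN_unit : - q \is a GRing.unit. Proof. by rewrite unitrN. Qed.

Lemma qsign_unit P i : qsign P i \is a GRing.unit.
Proof. by rewrite unitrV unitrX. Qed.

Lemma qsignD1_le P k l : (k <= l)%N -> qsign (P :\ k) l = qsign P l.
Proof. by move=> le_kl; rewrite /qsign gt_countD1_le. Qed.

Lemma qsignD1_gt P k l : k \in P -> (l < k)%N -> qsign (P :\ k) l = - q * qsign P l.
Proof.
by move=> kP lt_lk; rewrite /qsign (gt_countD1_gt kP lt_lk) -!exprVn exprS mulVKr.
Qed.

(* The coefficients of an element of the quantum exterior algebra, in which
   xi_j xi_i = - q^-1 xi_i xi_j for i < j, on the monomials
   xi_J = \prod_(j in J) xi_j. *)
Local Notation ext := {ffun {set 'I_r} -> M}.

Variable A : 'M[M]_r.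

(* Right multiplication by \sum_i A i j xi_i. *)
Definition ext_mul_col (j : 'I_r) (f : ext) : ext :=
  [ffun P : {set 'I_r} => \sum_(i in P) qsign P i *: (f (P :\ i) * A i j)].

Lemma ext_mul_colZ j c f : ext_mul_col j (c *: f) = c *: ext_mul_col j f.
Proof.
apply/ffunP => P; rewrite !ffunE scaler_sumr; apply: eq_bigr => i _.
by rewrite ffunE -scalerAl !scalerA mulrC.
Qed.

(** Rows k < l can be inserted in either order; inserting k before l carries an extra factor - q,
    which produces the bracket. *)
Lemma ext_mul_col2E i j f P :
  ext_mul_col i (ext_mul_col j f) P =
  \sum_(k in P) \sum_(l in P | (k < l)%N) (qsign P k * qsign P l) *:
    (f (P :\ k :\ l) * (A l j * A k i - q *: (A k j * A l i))).
Proof.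
pose T k l := (qsign P k * qsign (P :\ k) l) *: (f (P :\ k :\ l) * (A l j * A k i)).
transitivity (\sum_(k in P) (\sum_(l in P | (k < l)%N) T k l +
                              \sum_(l in P | (l < k)%N) T k l)).
  rewrite !ffunE; apply: eq_bigr => k kP; rewrite ffunE mulr_suml scaler_sumr.
  rewrite (bigID (fun l => (k < l)%N)) /=; congr (_ + _); apply: eq_big => l.
  - rewrite !inE; case: eqP => //= ->; by rewrite ltnn andbF.
  - by move=> _; rewrite -scalerAl scalerA -mulrA.
  - by rewrite !inE -leqNgt ltn_neqAle val_eqE; case: eqP; rewrite //= ?andbF.
  - by move=> _; rewrite -scalerAl scalerA -mulrA.
rewrite big_split /= [X in _ + X](exchange_big_dep (mem P)) => [|? ? _ /andP[]] //=.
rewrite -big_split /=; apply: eq_bigr => k kP.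
rewrite [X in _ + X](eq_bigl (fun l => (l \in P) && (k < l)%N)) => [|l]; last by rewrite kP.
rewrite -big_split /=; apply: eq_bigr => l /andP[lP lt_kl].
rewrite /T qsignD1_le 1?ltnW // qsignD1_gt // [P :\ l :\ k]setDDl setUC -setDDl.
rewrite mulrBr scalerBr; congr (_ + _); rewrite -scalerAr !scalerA -scaleNr.
congr (_ *: _). 
by rewrite mulNr mulrN mulrCA mulrC [qsign P l * _]mulrC.
Qed.

Hypothesis rqA : right_quantum q A.

Lemma ext_mul_col_sq j f : ext_mul_col j (ext_mul_col j f) = 0.
Proof.
apply/ffunP => P; rewrite ext_mul_col2E ffunE big1 // => k _.
by rewrite big1 // => l /andP[_ lt_kl]; rewrite (proj1 rqA) // subrr mulr0 scaler0.
Qed.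

(** The cross relation of [right_quantum] makes the brackets of [ext_mul_col2E] for the two orders
    of the columns proportional. *)
Lemma ext_mul_colC i j f : (i < j)%N ->
  ext_mul_col i (ext_mul_col j f) = (- q)^-1 *: ext_mul_col j (ext_mul_col i f).
Proof.
move=> lt_ij; apply/ffunP => P; rewrite [RHS]ffunE !ext_mul_col2E scaler_sumr.
apply: eq_bigr => k _; rewrite scaler_sumr; apply: eq_bigr => l /andP[_ lt_kl].
rewrite [RHS]scalerA [_^-1 * _]mulrC -[RHS]scalerA; congr (_ *: _).
rewrite [RHS]scalerAr; congr (_ * _).
rewrite scalerBr scalerA invrN mulNr mulVr // scaleN1r opprK (proj2 rqA _ _ _ _ lt_kl lt_ij).
by rewrite scaleNr addrA [X in _ = X - _]addrC addrK.
Qed.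

Lemma ext_mul_col_foldl j s f : all (fun l => j < l)%N s ->
  ext_mul_col j (foldl (fun g l => ext_mul_col l g) f s) =
  (- q) ^- size s *: foldl (fun g l => ext_mul_col l g) (ext_mul_col j f) s.
Proof.
elim/last_ind: s f => [|s l IHs] f; first by rewrite /= expr0 invr1 scale1r.
rewrite all_rcons !foldl_rcons size_rcons => /andP[lt_jl jls].
rewrite ext_mul_colC // IHs // ext_mul_colZ scalerA.
by rewrite -!exprVn exprS.
Qed.

(* [ext_minor J P] is the quantum minor with rows [P] and columns [J]. *)
Definition ext_minor_seq (s : seq 'I_r) : ext :=
  foldl (fun g j => ext_mul_col j g) [ffun P : {set 'I_r} => (P == set0)%:R] s.
Definition ext_minor J : ext := ext_minor_seq (enum J).

Lemma sorted_enum_set J : sorted (relpre val ltn) (enum J).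
Proof.
rewrite {1}/enum_mem -enumT; apply: sorted_filter => [x y z|].
  exact: ltn_trans.
by rewrite -sorted_map val_enum_ord iota_ltn_sorted.
Qed.

(** Both sides are strictly increasing lists with the same elements. The middle is the place of
    column j in [ext_minorM]. *)
Lemma enum_set_split J j :
  enum J = [seq l : 'I_r <- enum J | (l < j)%N] ++ (if j \in J then [:: j] else [::]) ++
           [seq l : 'I_r <- enum J | (j < l)%N].
Proof.
have tr : transitive (relpre (@nat_of_ord r) ltn) by move=> x y z; exact: ltn_trans.
apply: (irr_sorted_eq tr) => [x||| l]; first exact: ltnn.
- exact: sorted_enum_set.
- have sf a : sorted (relpre val ltn) (filter a (enum J)).
    by apply: sorted_filter (sorted_enum_set J).
  move: (sf (fun l => l < j)%N) (sf (fun l => j < l)%N).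
  rewrite /= !(sorted_pairwise tr) !pairwise_cat /= => -> ->.
  rewrite /= !andbT; apply/and3P; split; last by case: ifP.
    apply/allrelP => a b; rewrite mem_filter mem_cat => /andP[lt_aj _] /orP[].
      by case: ifP => // _; rewrite inE => /eqP->.
    by rewrite mem_filter => /andP[lt_jb _]; exact: ltn_trans lt_aj lt_jb.
  apply/allrelP => a b; rewrite mem_filter; case: ifP => // _.
  by rewrite inE => /eqP-> /andP[].
- have := mem_enum J l; move: (enum J) => e eJ; rewrite !mem_cat !mem_filter eJ.
  case: (ltngtP l j) => [lj|jl|/ord_inj->] //=; last by case: ifP => //; rewrite inE eqxx.
    by case: ifP; rewrite ?inE ?orbF // -val_eqE ltn_eqF // orbF.
  by case: ifP; rewrite ?inE // -val_eqE gtn_eqF.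
Qed.

Lemma gt_countE J j : gt_count J j = size [seq l : 'I_r <- enum J | (j < l)%N].
Proof.
rewrite /gt_count cardE; apply/perm_size/uniq_perm.
- exact: enum_uniq.
- exact/filter_uniq/enum_uniq.
- move=> l; rewrite mem_enum inE; have := mem_enum J l; move: (enum J) => e eJ.
  by rewrite mem_filter eJ andbC.
Qed.

Lemma enum_setU1_filter (a : pred 'I_r) J j : ~~ a j ->
  [seq l : 'I_r <- enum (j |: J) | a l] = [seq l : 'I_r <- enum J | a l].
Proof.
move=> aj; rewrite {1 2}/enum_mem -!filter_predI; apply: eq_filter => l /=.
by rewrite !inE; case: eqP => //= ->; rewrite (negPf aj).
Qed.

(** Xi_j moves left past the larger columns of J, each costing - q^-1. There it either meets another
    Xi_j and gives 0, or stands at its sorted place. *)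
Lemma ext_minorM j J : ext_mul_col j (ext_minor J) =
  if j \in J then 0 else qsign J j *: ext_minor (j |: J).
Proof.
have fold0 s : foldl (fun g l => ext_mul_col l g) 0 s = 0.
  elim: s => //= l s; rewrite (_ : ext_mul_col l 0 = 0) //.
  by rewrite -(scale0r (0 : ext)) ext_mul_colZ !scale0r.
have gtJ : all (fun l => j < l)%N [seq l : 'I_r <- enum J | (j < l)%N].
  by apply/allP => l; rewrite mem_filter => /andP[].
rewrite /ext_minor /ext_minor_seq {1}(enum_set_split J j).
case: ifP => jJ; rewrite !foldl_cat /= ext_mul_col_foldl //.
  by rewrite ext_mul_col_sq fold0 scaler0.
rewrite (enum_set_split (j |: J) j) setU11 !foldl_cat /=.
by rewrite !enum_setU1_filter ?ltnn // /qsign gt_countE.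
Qed.

End ExteriorMultiplication.

(** * Quantum minors as quantum determinants *)

Section MinorsAsDeterminants.
Context {K : comUnitRingType} (q : K) {M : algType K} {r : nat} (A : 'M[M]_r).

Lemma ltn_mono_inj n (f : 'I_n -> 'I_r) :
  {mono f : i j / (i < j)%N} -> injective f.
Proof.
move=> fmono i j eij; apply: ord_inj.
by have := fmono i j; have := fmono j i; rewrite eij ltnn; case: ltngtP.
Qed.

Lemma gt_count_imset n (f : 'I_n -> 'I_r) (k : 'I_n) :
  {mono f : i j / (i < j)%N} -> gt_count [set f i | i : 'I_n] (f k) = (n - k.+1)%N.
Proof.
move=> fmono; have finj := ltn_mono_inj fmono.
have lt_kn : (k < n)%N by [].
rewrite -(sum_leq_ord lt_kn) /gt_count -sum1dep_card.
rewrite (eq_bigl (fun l => (l \in [set f i | i : 'I_n]) && (f k < l)%N)) //.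
rewrite big_imset_cond /=; last by move=> ? ? _ _; exact: finj.
rewrite big_mkcond; apply: eq_bigr => i _; rewrite fmono.
by case: ifP.
Qed.

(** Induction on n: multiplying by the last column is the Laplace expansion. As f is increasing, n -
    k of the n + 1 rows exceed f k, so [qsign] is the coefficient in [qdet_expand_last]. *)
Lemma ext_minor_seqE n (f g : 'I_n -> 'I_r) :
  {mono f : i j / (i < j)%N} ->
  ext_minor_seq q A [seq g i | i <- enum 'I_n] [set f i | i : 'I_n] =
  qdet q (mxsub f g A).
Proof.
elim: n f g => [|n IHn] f g fmono.
  rewrite enum_ord0 /ext_minor_seq /= ffunE /qdet.
  have -> : [set f i | i : 'I_0] = set0 by apply/setP => l; rewrite inE; apply/imsetP => -[[]].
  rewrite eqxx (eq_bigl (pred1 1%g)) => [|s]; last by symmetry; apply/eqP/permP => -[].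
  rewrite big_pred1_eq big_ord0 perm_invE big_ord0 expr0 invr1 scale1r //.
rewrite qdet_expand_last enum_ordSr map_rcons -map_comp /ext_minor_seq foldl_rcons.
rewrite -/(ext_minor_seq q A _) ffunE.
have finj := ltn_mono_inj fmono.
rewrite big_imset /=; last by move=> ? ? _ _; exact: finj.
apply: eq_bigr => k _; rewrite /qsign gt_count_imset // subSS mxE.
congr (_ *: (_ * _)).
have -> : mxsub (lift k) (lift ord_max) (mxsub f g A) =
    mxsub (f \o lift k) (g \o lift ord_max) A.
  by apply/matrixP => i j; rewrite !mxE.
rewrite -IHn => [|i j]; last by rewrite /= fmono ltn_lift.
congr (ext_minor_seq q A _ _).
  apply: eq_map => i /=; congr g; apply: ord_inj; by rewrite lift_max.
apply/setP => l; rewrite !inE; apply/andP/imsetP => [[ne /imsetP[i _ El]]|[i _ ->]].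
  have [i' Ei|Ei] := unliftP k i; last by rewrite El Ei eqxx in ne.
  by exists i'; rewrite // El Ei.
by rewrite /= (inj_eq finj) eq_sym neq_lift imset_f.
Qed.

Lemma enum_val_mono (J : {set 'I_r}) : {mono (@enum_val _ (mem J)) : i j / (i < j)%N}.
Proof.
have homo : {homo (@enum_val _ (mem J)) : i j / (i < j)%N}.
  move=> i j lt_ij; have x0 := enum_val i; rewrite !(enum_val_nth x0).
  apply: (sorted_ltn_nth (leT := relpre val ltn)) => //.
  - by move=> x y z; exact: ltn_trans.
  - exact: sorted_enum_set.
  - by rewrite inE -cardE.
  - by rewrite inE -cardE.
move=> i j; have [lt_ij|lt_ji|/ord_inj->] := ltngtP i j; last by rewrite ltnn.
  by rewrite homo.
by apply/negbTE; rewrite -leqNgt ltnW // homo.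
Qed.

Lemma ext_minor_diag (J : {set 'I_r}) :
  ext_minor q A J J = qdet q (principal_submx A J).
Proof.
rewrite /principal_submx -(ext_minor_seqE _ (@enum_val_mono J)).
have im : [set enum_val i | i : 'I_#|J|] = J.
  apply/setP => l; apply/imsetP/idP => [[i _ ->]|lJ]; first exact: enum_valP.
  by exists (enum_rank_in lJ l); rewrite // enum_rankK_in.
rewrite [in RHS]im /ext_minor; congr (ext_minor_seq q A _ _).
have tr : transitive (relpre (@nat_of_ord r) ltn) by move=> x y z; exact: ltn_trans.
apply: (irr_sorted_eq tr) => [x|||l]; first exact: ltnn.
- exact: sorted_enum_set.
- rewrite sorted_map (eq_sorted (e' := relpre val ltn)) => [|i j].
    by rewrite -sorted_map val_enum_ord iota_ltn_sorted.
  exact: enum_val_mono.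
- rewrite mem_enum -[in LHS]im; apply/imsetP/mapP => -[i _ ->]; exists i => //.
  by rewrite mem_enum.
Qed.
End MinorsAsDeterminants.

(** * Quantum symmetric powers *)

Section SymmetricPowers.
Context {K : comUnitRingType} (q : K) {M : algType K} {r : nat}.
Local Notation S := (qspace q M r).
Local Notation mon := (@qspace_mon K q M r).
Implicit Types (i j k l : 'I_r) (m n u : xmon r) (f g : S).

(** Truncated subtraction leaves u unchanged when u j = 0, whence the conditions 0 < u j below. *)
Definition xmonB u j : xmon r := [ffun i => (u i - (i == j))%N].

Lemma xmonUDK j m : xmonB (xmonD (xmonU j) m) j = m.
Proof. by apply/ffunP => i; rewrite !ffunE addKn. Qed.

Lemma xmonUBK j u : (0 < u j)%N -> xmonD (xmonU j) (xmonB u j) = u.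
Proof.
move=> u_gt0; apply/ffunP => i; rewrite !ffunE.
by case: eqP => [->|_]; rewrite ?subn0 // subnKC.
Qed.

Lemma xmon_invUl i m : xmon_inv (xmonU i) m = (\sum_(j < r | j < i) m j)%N.
Proof.
rewrite /xmon_inv -(pair_big_dep xpredT (fun a b : 'I_r => (a < b)%N)
  (fun a b => xmonU i b * m a)%N) /= [RHS]big_mkcond; apply: eq_bigr => a _.
rewrite big_mkcond (bigD1 i) //= big1 => [|b /negPf bi].
  by rewrite !ffunE eqxx mul1n addn0.
by rewrite ffunE bi mul0n if_same.
Qed.

(** The quantum space has left scalars in the noncommutative M; those coming from K are central and
    can be pulled across f. *)
Lemma qspace_scaleAr (c : K) f g : f * ((c%:A : M) *: g) = (c%:A : M) *: (f * g).
Proof.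
rewrite [f]qspaceE [g]qspaceE scaler_sumr !big_distrlr /= scaler_sumr.
apply: eq_bigr => m _; rewrite scaler_sumr; apply: eq_bigr => n _.
rewrite !(qspace_monM, qspace_scale_mon); congr mon.
by rewrite !mulr_algl -scalerAr !scalerA mulrC.
Qed.

Lemma mcoeff_qspace_xM j f u :
  (qspace_x q M j * f)@_u =
  if (0 < u j)%N then q ^+ xmon_inv (xmonU j) (xmonB u j) *: f@_(xmonB u j) else 0.
Proof.
rewrite [f in LHS]qspaceE mulr_sumr raddf_sum /=.
under eq_bigr => m _ do rewrite qspace_monM mul1r mcoeffU.
case: ifP => u_gt0.
  have [fu|/mcoeff_outdom fu] := boolP (xmonB u j \in msupp f).
    rewrite (big_fsetD1 _ fu) /= xmonUBK // eqxx mulr1n big1_fset ?addr0 // => m.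
    rewrite in_fsetD1 => /andP[/negPf ne _] _; case: eqP => [Du|]; last by rewrite mulr0n.
    by rewrite -Du xmonUDK eqxx in ne.
  rewrite fu scaler0 big1 // => m _; case: eqP => [Du|]; last by rewrite mulr0n.
  by rewrite -Du xmonUDK in fu; rewrite fu scaler0 mul0rn.
rewrite big1 // => m _; case: eqP => [Du|]; last by rewrite mulr0n.
by rewrite -Du !ffunE eqxx in u_gt0.
Qed.

Variable A : 'M[M]_r.
Local Notation X := (qspace_X q A).
Local Notation Xmon := (qspace_Xmon q A).

Lemma mcoeff_qspace_XM i f u :
  (X i * f)@_u = \sum_(j < r | (0 < u j)%N)
     q ^+ xmon_inv (xmonU j) (xmonB u j) *: (A i j * f@_(xmonB u j)).
Proof.
rewrite /qspace_X mulr_suml raddf_sum /= [RHS]big_mkcond; apply: eq_bigr => j _.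
rewrite -qspace_scaleAl mcoeffZ mcoeff_qspace_xM.
by case: ifP => _; rewrite ?mulr0 // scalerAr.
Qed.

Hypothesis hq : q \is a GRing.unit.
Hypothesis rqA : right_quantum q A.

Lemma sum_ord_pairs (V : nmodType) (F : 'I_r -> 'I_r -> V) :
  \sum_(k < r) \sum_(l < r) F k l =
  \sum_(k < r) (F k k + \sum_(l < r | (k < l)%N) (F k l + F l k)).
Proof.
transitivity (\sum_(k < r) (F k k + \sum_(l < r | (k < l)%N) F k l) +
              \sum_(k < r) \sum_(l < r | (l < k)%N) F k l).
  rewrite -big_split; apply: eq_bigr => k _ /=.
  rewrite (bigD1 k) //= -addrA; congr (_ + _).
  rewrite (bigID (fun l => (k < l)%N)) /=; congr (_ + _); apply: eq_bigl => l.
    by rewrite -val_eqE /=; case: ltngtP.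
  by rewrite -val_eqE /=; case: ltngtP.
rewrite [X in _ + X](exchange_big_dep xpredT) //= -big_split /=.
by apply: eq_bigr => k _; rewrite -addrA big_split.
Qed.

(** Comparing coefficients, x_k^2 needs the column relation and x_k x_l with k < l the cross
    relation. *)
Lemma qspace_XC i j : (i < j)%N -> X j * X i = (q%:A : M) *: (X i * X j).
Proof.
move=> lt_ij.
pose T i j k l := mon (q ^+ (l < k)%N *: (A i k * A j l)) (xmonD (xmonU k) (xmonU l)).
have XX a b : X a * X b = \sum_(k < r) \sum_(l < r) T a b k l.
  rewrite mulr_suml; apply: eq_bigr => k _; rewrite mulr_sumr; apply: eq_bigr => l _.
  by rewrite !qspace_scale_mon !mulr1 qspace_monM xmon_invU.
rewrite !XX !sum_ord_pairs scaler_sumr; apply: eq_bigr => k _.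
rewrite scalerDr scaler_sumr /T ltnn expr0 !scale1r; congr (_ + _).
  by rewrite qspace_scale_mon mulr_algl (proj1 rqA).
apply: eq_bigr => l lt_kl; rewrite lt_kl ltnNge ltnW //= expr0 expr1 !scale1r.
rewrite [xmonD (xmonU l) _]xmonDC -!qspace_monD qspace_scale_mon; congr mon.
rewrite mulr_algl (proj2 rqA _ _ _ _ lt_ij lt_kl) addrC subrK scalerDr scalerA mulrV //.
by rewrite scale1r addrC.
Qed.

Lemma qspace_XXn i j (n : nat) : (i < j)%N ->
  X j * X i ^+ n = ((q ^+ n)%:A : M) *: (X i ^+ n * X j).
Proof.
move=> lt_ij; elim: n => [|n IHn]; first by rewrite !expr0 scale1r mul1r mulr1 scale1r.
rewrite exprSr mulrA IHn -qspace_scaleAl -mulrA (qspace_XC lt_ij) qspace_scaleAr.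
by rewrite scalerA -mulrA exprSr mulr_algl scalerA.
Qed.

(** X_i passes every X_j with j < i, gaining q each time, as x_i does in x_i x^m. Thus replacing x^m
    by X^m turns left multiplication by x_i into that by X_i. *)
Lemma qspace_XXmon i m :
  X i * Xmon m = ((q ^+ xmon_inv (xmonU i) m)%:A : M) *: Xmon (xmonD (xmonU i) m).
Proof.
(* Extending the factors by 1 to all natural indices lets the product be cut at i. *)
pose F m (k : nat) : S := if (insub k : option 'I_r) is Some j then X j ^+ m j else 1.
have FE m' j : F m' j = X j ^+ m' j by rewrite /F valK.
have XmonE m' : Xmon m' =
    \prod_(0 <= a < i) F m' a * X i ^+ m' i * \prod_(i.+1 <= a < r) F m' a.
  rewrite /qspace_Xmon (eq_bigr (fun j : 'I_r => F m' j)) => [|j _]; last by rewrite FE.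
  rewrite -(big_mkord xpredT (F m')) (@big_cat_nat _ _ _ i) //=; last exact: ltnW.
  by rewrite (big_ltn (ltn_ord i)) FE mulrA.
have FD (k : nat) : k != i -> F (xmonD (xmonU i) m) k = F m k.
  move=> ne_ki; rewrite /F; case: insubP => // j _ jk.
  by rewrite !ffunE -val_eqE jk /= (negPf ne_ki).
have XP (k : nat) : (k <= i)%N -> X i * \prod_(0 <= a < k) F m a =
    ((q ^+ \sum_(j < r | (j < k)%N) m j)%:A : M) *: (\prod_(0 <= a < k) F m a * X i).
  elim: k => [_|k IHk lt_ki].
    by rewrite big_geq // big_pred0 // expr0 scale1r mulr1 mul1r scale1r.
  have lt_kr : (k < r)%N by exact: ltn_trans lt_ki (ltn_ord i).
  rewrite big_nat_recr //= mulrA IHk 1?ltnW // -qspace_scaleAl -mulrA.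
  rewrite (FE m (Ordinal lt_kr)) qspace_XXn // qspace_scaleAr scalerA mulr_algl scalerA.
  rewrite -exprD mulrA [in RHS](bigD1 (Ordinal lt_kr)) ?leqnn //= [in RHS]addnC.
  congr ((q ^+ (_ + _))%:A *: _).
  apply: eq_bigl => j; rewrite -val_eqE /=.
  by rewrite ltnS; case: ltngtP.
rewrite !XmonE !mulrA XP // xmon_invUl -!qspace_scaleAl; congr (_ *: _).
congr (_ * _); last first.
  by apply: eq_big_nat => k /andP[lt_ik _]; rewrite FD // gtn_eqF.
rewrite -mulrA -exprS; congr (_ * _ ^+ _); last by rewrite !ffunE eqxx.
by apply: eq_big_nat => k /andP[_ lt_ki]; rewrite FD // ltn_eqF.
Qed.

End SymmetricPowers.

(** * The Koszul complex *)

Section KoszulComplex.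
Context {K : comUnitRingType} (q : K) {r : nat}.
Local Notation cell := ({set 'I_r} * xmon r)%type.
Implicit Types (x y z : cell) (i j p : 'I_r).

(* The basis of \bigoplus_k \Lambda^k \otimes S^(n - k). *)
Definition koszul_basis (n : nat) : seq cell :=
  [seq (J, xmon_of m) | J : {set 'I_r} <- enum [pred J : {set 'I_r} | (#|J| <= n)%N],
                        m : deg_xmon r (n - #|J|) <- enum {: deg_xmon r (n - #|J|)}].

Lemma xmon_of_inj n : injective (@xmon_of r n).
Proof.
move=> m m' /ffunP eqm; apply/val_inj/ffunP => i; apply: val_inj.
by have := eqm i; rewrite !ffunE.
Qed.

Lemma mem_koszul_basis n x :
  (x \in koszul_basis n) = (#|x.1| + \sum_i x.2 i == n)%N.
Proof.
apply/allpairsPdep/eqP => [[J [m [+ _ ->]]]|Dn].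
  rewrite mem_enum inE => leJ /=; under eq_bigr do rewrite ffunE.
  by have /eqP -> := valP m; rewrite subnKC.
have leJ : (#|x.1| <= n)%N by rewrite -Dn leq_addr.
have lt_x i : (x.2 i < (n - #|x.1|).+1)%N by rewrite -Dn addKn (bigD1 i) //= ltnS leq_addr.
have deg_x : (\sum_i [ffun i => Ordinal (lt_x i)] i == n - #|x.1|)%N.
  by under eq_bigr do rewrite ffunE /=; rewrite -Dn addKn.
pose in_range (m : {ffun 'I_r -> 'I_(n - #|x.1|).+1}) := (\sum_i m i == n - #|x.1|)%N.
exists x.1, (exist in_range _ deg_x); split; rewrite ?mem_enum ?inE //.
by rewrite [LHS]surjective_pairing; congr (_, _); apply/ffunP => i; rewrite !ffunE.
Qed.

Lemma koszul_basis_uniq n : uniq (koszul_basis n).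
Proof.
apply: allpairs_uniq_dep => [|J _|]; rewrite ?enum_uniq //.
by move=> [J m] [J' m'] _ _ /= [eJ]; case: _ / eJ m' => m' /xmon_of_inj ->.
Qed.

Lemma sum_koszul_basis (V : nmodType) n (F : {set 'I_r} -> xmon r -> V) :
  \sum_(x <- koszul_basis n) F x.1 x.2 =
  \sum_(J : {set 'I_r} | (#|J| <= n)%N) \sum_(m : deg_xmon r (n - #|J|)) F J (xmon_of m).
Proof.
rewrite big_allpairs_dep /= big_enum /=; apply: eq_bigr => J _.
by rewrite big_enum.
Qed.

Definition koszul_move x i : cell := (x.1 :\ i, xmonD (xmonU i) x.2).
Definition koszul_back x i : cell := (i |: x.1, xmonB x.2 i).
(** For x = (P, m), the first factor is the coefficient of xi_P in xi_(P \ i) xi_i, the second that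
    of x^(e_i + m) in x_i x^m. The differential removes xi_i and multiplies by x_i, summed over
    i. *)
Definition koszul_coef x i : K := qsign q x.1 i * q ^+ xmon_inv (xmonU i) x.2.

Lemma koszul_moveK x i : i \in x.1 -> koszul_back (koszul_move x i) i = x.
Proof. by move=> ix; case: x ix => J m /= iJ; rewrite /koszul_back /= setD1K // xmonUDK. Qed.

Lemma koszul_backK x i : i \notin x.1 -> (0 < x.2 i)%N ->
  koszul_move (koszul_back x i) i = x.
Proof. by case: x => J m /= iJ mi; rewrite /koszul_move /= setU1K // xmonUBK. Qed.

Lemma koszul_moveC x i j :
  koszul_move (koszul_move x i) j = koszul_move (koszul_move x j) i.
Proof.
by rewrite /koszul_move /= !setDDl setUC !xmonDA [xmonD (xmonU i) _]xmonDC.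
Qed.

Lemma koszul_move_eq x y i : i \in x.1 ->
  (y == koszul_move x i) =
  [&& i \notin y.1, (0 < y.2 i)%N & x == koszul_back y i].
Proof.
move=> ix; apply/eqP/and3P => [->|[iy y_gt0 /eqP ->]]; last by rewrite koszul_backK.
by rewrite /= setD11 !ffunE eqxx koszul_moveK.
Qed.

Lemma koszul_basis_move n x i : i \in x.1 ->
  (koszul_move x i \in koszul_basis n) = (x \in koszul_basis n).
Proof.
move=> ix; rewrite !mem_koszul_basis (cardsD1 i x.1) ix /=.
under eq_bigr do rewrite ffunE; rewrite big_split /= (bigD1 i) //= big1 => [|j /negPf ji].
  by rewrite ffunE eqxx addn0 addnCA addnA.
by rewrite ffunE ji.
Qed.

(** A move shifts a letter between the two factors, so this set is invariant, and so is a pivot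
    chosen from it. *)
Definition koszul_supp x := x.1 :|: [set i | (0 < x.2 i)%N].
Definition koszul_pivot x := [pick i in koszul_supp x].

Lemma koszul_pivot_move x i : i \in x.1 ->
  koszul_pivot (koszul_move x i) = koszul_pivot x.
Proof.
move=> ix; rewrite /koszul_pivot /koszul_supp; apply: eq_pick => j /=.
by rewrite !inE !ffunE; case: eqP => [->|] //=; rewrite ix.
Qed.

Definition koszul_diff x y : K :=
  \sum_(i in x.1) koszul_coef x i *+ (y == koszul_move x i).

(* Moves the pivot from the symmetric to the exterior factor; any choice of
   pivot that depends only on [koszul_supp] gives a contracting homotopy. *)
Definition koszul_homotopy x y : K :=
  \sum_(p in y.1 | koszul_pivot y == Some p)
    (koszul_coef y p)^-1 *+ (x == koszul_move y p).

Hypothesis hq : q \is a GRing.unit.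

Lemma koszul_coef_unit x i : koszul_coef x i \is a GRing.unit.
Proof. by rewrite unitrM qsign_unit ?unitrX. Qed.

(** The coefficient form of d^2 = 0: for i < j, the - q of [qsignD1_gt] on one side balances the q
    of x_j x_i = q x_i x_j on the other. *)
Lemma koszul_coef_cross x i j : i \in x.1 -> j \in x.1 -> i != j ->
  koszul_coef x i * koszul_coef (koszul_move x i) j =
  - (koszul_coef x j * koszul_coef (koszul_move x j) i).
Proof.
wlog lt_ij : i j / (i < j)%N => [H ix jx ne_ij|ix jx _].
  have [lt_ij|le_ji] := ltnP i j; first exact: H.
  rewrite [in RHS]H ?opprK // 1?eq_sym // ltn_neqAle le_ji andbT.
  by rewrite val_eqE eq_sym.
rewrite /koszul_coef /= !xmon_invDr !xmon_invU lt_ij ltnNge ltnW //= add0n.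
rewrite qsignD1_le 1?ltnW // qsignD1_gt // exprS; ring.
Qed.

Lemma sum_delta (V : lmodType K) (I : eqType) (s : seq I) (F : I -> V) c a :
  uniq s -> \sum_(z <- s) (c *+ (z == a)) *: F z = (if a \in s then c *: F a else 0).
Proof.
move=> us; case: ifP => [as_|/negP nas].
  rewrite (bigD1_seq a) //= eqxx big1 ?addr0 // => z /negPf->.
  by rewrite mulr0n scale0r.
rewrite big_seq big1 // => z zs; case: eqP => [za|]; last by rewrite mulr0n scale0r.
by rewrite za in zs.
Qed.

Lemma koszul_diff_rowE (V : lmodType K) n x (F : cell -> V) : x \in koszul_basis n ->
  \sum_(z <- koszul_basis n) koszul_diff x z *: F z =
  \sum_(i in x.1) koszul_coef x i *: F (koszul_move x i).
Proof.
move=> xn; under eq_bigr do rewrite scaler_suml.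
rewrite exchange_big /=; apply: eq_bigr => i ix.
by rewrite sum_delta ?koszul_basis_uniq // koszul_basis_move ?xn.
Qed.

Lemma koszul_diff_colE (V : lmodType K) n y (F : cell -> V) : y \in koszul_basis n ->
  \sum_(z <- koszul_basis n) koszul_diff z y *: F z =
  \sum_(j | (j \notin y.1) && (0 < y.2 j)%N)
     koszul_coef (koszul_back y j) j *: F (koszul_back y j).
Proof.
move=> yn; under eq_bigr do rewrite scaler_suml big_mkcond.
rewrite exchange_big /= [RHS]big_mkcond; apply: eq_bigr => j _.
case: ifP => [/andP[jy y_gt0]|nj].
  have j_back : j \in (koszul_back y j).1 by rewrite setU11.
  have back_in : koszul_back y j \in koszul_basis n.
    by rewrite -(koszul_basis_move _ j_back) koszul_backK.
  rewrite (bigD1_seq _ back_in) ?koszul_basis_uniq //= setU11 koszul_backK // eqxx mulr1n.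
  rewrite big1 ?addr0 // => z /negPf nz; case: ifP => // jz.
  by rewrite koszul_move_eq // nz !andbF mulr0n scale0r.
rewrite big1 // => z _; case: ifP => // jz.
by rewrite koszul_move_eq // andbA nj mulr0n scale0r.
Qed.

(** The definition reads the pivot off y; as moves preserve pivots, x determines it too and selects
    the only y with a nonzero entry. *)
Lemma koszul_homotopyE x y p : koszul_pivot x = Some p ->
  koszul_homotopy x y =
  if p \notin x.1 then (koszul_coef y p)^-1 *+ (y == koszul_back x p) else 0.
Proof.
move=> pivx; have px : p \in koszul_supp x.
  by move: pivx; rewrite /koszul_pivot; case: pickP => // p' ? [<-].
have xp_gt0 : p \notin x.1 -> (0 < x.2 p)%N by move: px; rewrite !inE; case: (p \in x.1).
have [/andP[pNx /eqP Dy]|nb] := boolP ((p \notin x.1) && (y == koszul_back x p)).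
  have py : p \in y.1 by rewrite Dy setU11.
  have Dx : x = koszul_move y p by rewrite Dy koszul_backK // xp_gt0.
  have pivy : koszul_pivot y = Some p by rewrite -pivx Dx koszul_pivot_move.
  rewrite pNx -Dy eqxx mulr1n /koszul_homotopy (big_pred1 p) => [|i]; last first.
    by rewrite pivy; apply/andP/eqP => [[_ /eqP[->]]|->]; rewrite ?py ?eqxx.
  by rewrite -Dx eqxx mulr1n.
transitivity (0 : K).
  rewrite /koszul_homotopy big1 // => i /andP[iy /eqP pivy].
  case: eqP => [Dx|]; last by rewrite mulr0n.
  move: pivx; rewrite Dx koszul_pivot_move // pivy => -[Dp].
  by rewrite Dx -Dp /= setD11 koszul_moveK // eqxx in nb.
by move: nb; case: (p \notin x.1) => //= /negPf->; rewrite mulr0n.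
Qed.

Lemma koszul_homotopyP n : (0 < n)%N ->
  {in koszul_basis n &, forall x y,
    \sum_(z <- koszul_basis n) koszul_homotopy x z * koszul_diff z y +
    \sum_(z <- koszul_basis n) koszul_diff x z * koszul_homotopy z y = (x == y)%:R}.
Proof.
move=> n_gt0 x y xn yn.
(* In positive degree some letter occurs in x. *)
have [p pivx] : exists p, koszul_pivot x = Some p.
  rewrite /koszul_pivot; case: pickP => [p|none]; first by exists p.
  move: xn; rewrite mem_koszul_basis => /eqP Dn.
  move: n_gt0; rewrite -Dn eq_card0 ?big1 // => i.
    move=> _; apply/eqP; rewrite -leqn0 leqNgt.
    by apply: contraFN (none i) => xi_gt0; rewrite !inE xi_gt0 orbT.
  by apply: contraFF (none i) => ix; rewrite !inE ix.
have px : p \in koszul_supp x.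
  by move: pivx; rewrite /koszul_pivot; case: pickP => // p' ? [<-].
rewrite (koszul_diff_rowE (V := K^o) (koszul_homotopy^~ y) xn).
have pivm i : i \in x.1 -> koszul_pivot (koszul_move x i) = Some p.
  by move=> ix; rewrite koszul_pivot_move.
under eq_bigr => z _ do rewrite (koszul_homotopyE _ pivx).
under [X in _ + X]eq_bigr => i ix do rewrite (koszul_homotopyE _ (pivm i ix)).
(* If p is exterior in x, the sum h d vanishes, and in d h only the move of p itself contributes:
   any other move leaves p exterior. *)
have [pinx|pNx] /= := boolP (p \in x.1).
  rewrite big1 ?add0r => [|z _]; last by rewrite mul0r.
  rewrite (bigD1 p) //= setD11 /= koszul_moveK // big1 ?addr0 => [|i /andP[ix ne_ip]].
    rewrite [y == x]eq_sym; case: eqP => [->|]; last by rewrite mulr0n scaler0.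
    by rewrite mulr1n; exact: mulrV (koszul_coef_unit _ _).
  by rewrite !inE eq_sym ne_ip pinx scaler0.
have xp_gt0 : (0 < x.2 p)%N by move: px; rewrite !inE (negPf pNx).
(* Otherwise h leads from x only to u. The p-term of d u y gives the identity, and the terms i in
   x.1 cancel against d h. *)
set u := koszul_back x p.
have pu : p \in u.1 by rewrite setU11.
have Dx : koszul_move u p = x by rewrite koszul_backK.
have un : u \in koszul_basis n by rewrite -(koszul_basis_move _ pu) Dx.
rewrite (bigD1_seq u) ?koszul_basis_uniq //= eqxx mulr1n.
rewrite [X in _ + X + _]big1 ?addr0 => [|z /negPf->]; last by rewrite mulr0n mul0r.
rewrite /koszul_diff big_setU1 //= Dx mulrDr mulrnAr mulVr ?koszul_coef_unit //.
rewrite [y == x]eq_sym -addrA mulr_sumr -big_split /= big1 ?addr0 // => i ix.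
have iu : i \in u.1 by rewrite !inE ix orbT.
have ne_ip : i != p by apply: contraNneq pNx => <-.
have pm : p \in (koszul_move u i).1 by rewrite !inE eq_sym ne_ip eqxx.
have -> : koszul_back (koszul_move x i) p = koszul_move u i.
  by rewrite -Dx koszul_moveC koszul_moveK.
rewrite in_setD1 negb_and pNx orbT.
case: eqP => [Dy|]; last by rewrite !mulr0n mulr0 scaler0 addr0.
(* Multiplied by two units, the cancellation becomes [koszul_coef_cross] for u, i and p. *)
rewrite !mulr1n; apply: (mulrI (koszul_coef_unit u p)).
apply: (mulIr (koszul_coef_unit y p)).
rewrite mulr0 mul0r mulrDr mulrDl mulVKr ?koszul_coef_unit //.
rewrite Dy koszul_coef_cross // Dx -[_ *: _]/(_ * _) -!mulrA mulVr ?koszul_coef_unit //.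
by rewrite mulr1 addNr.
Qed.

End KoszulComplex.

(** * The boson-fermion identity *)

Section BosonFermion.
Context {K : comUnitRingType} (q : K) {M : algType K} {r : nat} (A : 'M[M]_r).
Hypothesis hq : q \is a GRing.unit.
Hypothesis rqA : right_quantum q A.

(** D \otimes G. As [ext_minor] takes the columns first, x is the row index in both factors. *)
Definition koszul_mx (x y : {set 'I_r} * xmon r) : M :=
  ext_minor q A y.1 x.1 * (qspace_Xmon q A x.2)@_(y.2).

Lemma koszul_mx_diff n : {in koszul_basis n &, forall x y,
  \sum_(z <- koszul_basis n) koszul_diff q z y *: koszul_mx x z =
  \sum_(z <- koszul_basis n) koszul_diff q x z *: koszul_mx z y}.
Proof.
move=> x y xn yn; rewrite (koszul_diff_colE _ _ yn) (koszul_diff_rowE _ _ xn).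
(* The coefficient of xi_P x^u in Xi_J (\sum_j Xi_j x_j) X^m, where P = x.1, J = y.1, m = x.2 and u
   = y.2. *)
transitivity (\sum_(j < r | (0 < y.2 j)%N) q ^+ xmon_inv (xmonU j) (xmonB y.2 j) *:
    (ext_mul_col q A j (ext_minor q A y.1) x.1 * (qspace_Xmon q A x.2)@_(xmonB y.2 j))).
  rewrite big_mkcondl; apply: eq_bigr => j _; rewrite ext_minorM //.
  have [jy|jy] /= := boolP (j \in y.1); first by rewrite ffunE mul0r scaler0.
  rewrite ffunE.
  by rewrite /koszul_coef /koszul_mx /qsign gt_countU1 /= mulrC -scalerA scalerAl.
(* Expanding Xi_j over the rows i and summing over j first makes X_i X^m appear. *)
under eq_bigr => j _ do rewrite ffunE mulr_suml scaler_sumr.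
rewrite exchange_big; apply: eq_bigr => i ix /=.
rewrite /koszul_coef /koszul_mx /= -scalerA.
under eq_bigr => j _ do rewrite -scalerAl scalerA mulrC -scalerA -mulrA scalerAr.
rewrite -scaler_sumr -mulr_sumr -mcoeff_qspace_XM qspace_XXmon //.
by rewrite mcoeffZ mulr_algl -scalerAr.
Qed.

Lemma sum_qdet_tr_qsym n :
  \sum_(J : {set 'I_r} | (#|J| <= n)%N)
    (-1) ^+ #|J| *: (qdet q (principal_submx A J) * \tr (qsym q (n - #|J|) A)) =
  (n == 0%N)%:R.
Proof.
transitivity (\sum_(x <- koszul_basis n) (-1) ^+ #|x.1| *: koszul_mx x x).
  rewrite (sum_koszul_basis n (fun J m => (-1) ^+ #|J| *: koszul_mx (J, m) (J, m))).
  apply: eq_bigr => J _; rewrite tr_qsym -ext_minor_diag mulr_sumr scaler_sumr.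
  by [].
case: n => [|n].
  (* In degree 0 the only cell is that of the empty monomials, with entry 1. *)
  have in0 : (set0, xmon1 r) \in koszul_basis 0.
    by rewrite mem_koszul_basis cards0 big1 // => i _; rewrite ffunE.
  rewrite (bigD1_seq _ in0) ?koszul_basis_uniq //= big_seq_cond big1 => [|[J m]].
    rewrite cards0 expr0 scale1r addr0 /koszul_mx /=.
    rewrite /ext_minor /ext_minor_seq enum_set0 /= ffunE eqxx mul1r.
    rewrite /qspace_Xmon big1 => [|i _]; last by rewrite ffunE expr0.
    by rewrite [1]/(qspace_one q M r) mcoeffUU.
  rewrite mem_koszul_basis addn_eq0 /= => /andP[/andP[/eqP J0 /eqP m0] /eqP[]].
  congr (_, _); first exact: cards0_eq.
  by apply/ffunP => i; rewrite ffunE; apply/eqP; rewrite -leqn0 -m0 (bigD1 i) //= leq_addr.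
apply: (alternating_trace_eq0 (d := koszul_diff q) (h := koszul_homotopy q)).
- exact: koszul_basis_uniq.
- exact: koszul_mx_diff.
- exact: koszul_homotopyP.
(* A move lowers the exterior degree by one, so d anticommutes with the sign. *)
- move=> x y; rewrite -mulrN /koszul_diff !mulr_suml; apply: eq_bigr => i ix.
  case: eqP => [->|]; last by rewrite mulr0n !mul0r.
  by rewrite (cardsD1 i x.1) ix /= exprS mulN1r opprK.
Qed.

Variable g : grading M.
Hypothesis homogZ : forall (c : K) n (x : M), x \in homog g n -> c *: x \in homog g n.
Hypothesis homogA : forall i j, A i j \in homog g 1.

Lemma prod_homog1 n (F : 'I_n -> M) :
  (forall i, F i \in homog g 1) -> \prod_(i < n) F i \in homog g n.
Proof.
elim: n F => [|n IHn] F hF; first by rewrite big_ord0 homog1.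
by rewrite big_ord_recl; apply: (homogM (hF ord0)); apply: IHn.
Qed.

Lemma qdet_homog n (B : 'M[M]_n) : (forall i j, B i j \in homog g 1) ->
  qdet q B \in homog g n.
Proof. by move=> hB; apply: rpred_sum => s _; apply/homogZ/prod_homog1. Qed.

Lemma gcomp_Ferm n : g n (Ferm q A) =
  \sum_(J : {set 'I_r} | #|J| == n) (-1) ^+ #|J| *: qdet q (principal_submx A J).
Proof.
rewrite /Ferm raddf_sum [RHS]big_mkcond; apply: eq_bigr => J _ /=.
have -> : (-1) ^+ #|J| * qdet q (principal_submx A J) =
    (-1) ^+ #|J| *: qdet q (principal_submx A J).
  by rewrite -[in RHS]signr_odd scaler_sign -[in LHS]signr_odd mulr_sign.
have /eqP <- : (-1) ^+ #|J| *: qdet q (principal_submx A J) \in homog g #|J|.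
  by apply/homogZ/qdet_homog => i j; rewrite mxE.
by rewrite gcomp_id eq_sym.
Qed.

Lemma gcomp0_Ferm : g 0%N (Ferm q A) = 1.
Proof.
rewrite gcomp_Ferm (big_pred1 set0) => [|J]; last by rewrite cards_eq0.
rewrite -(ext_minor_diag q A set0) /ext_minor /ext_minor_seq enum_set0 /=.
by rewrite ffunE cards0 expr0 scale1r eqxx.
Qed.

Lemma qspace_XM_homog i (f : qspace q M r) n : (forall u, f@_u \in homog g n) ->
  forall u, (qspace_X q A i * f)@_u \in homog g n.+1.
Proof.
move=> hf u; rewrite mcoeff_qspace_XM; apply: rpred_sum => j _; apply: homogZ.
by rewrite -add1n; apply: homogM.
Qed.

Lemma qspace_Xmon_homog (m u : xmon r) : (qspace_Xmon q A m)@_u \in homog g (\sum_i m i).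
Proof.
rewrite /qspace_Xmon; move: u; elim/big_rec2: _ => [|i n f _ IH] u.
  by rewrite mcoeffU; case: eqP => _; rewrite ?homog1 ?rpred0.
elim: (m i) u => [|k IHk] u; first by rewrite expr0 mul1r.
by rewrite exprS -mulrA addSn; apply: qspace_XM_homog.
Qed.

Lemma tr_qsym_homog n : \tr (qsym q n A) \in homog g n.
Proof.
rewrite tr_qsym; apply: rpred_sum => m _; have := qspace_Xmon_homog (xmon_of m) (xmon_of m).
by under eq_bigr do rewrite ffunE; have /eqP -> := valP m.
Qed.

(** Since tr S^n(A) is homogeneous of degree n, the sequence of traces is itself an element of the
    completion. *)
Definition tr_qsym_completion : completion g := Completion tr_qsym_homog.

Lemma tr_qsym_series :
  completion_series (fun n => to_completion g (\tr (qsym q n A))) tr_qsym_completion.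
Proof.
(* Only the term n = d has a part of degree d, hence d + 1 terms suffice. *)
move=> d; exists d.+1 => N lt_dN.
have coef_sum m (u : 'I_m -> completion g) : (\sum_n u n) d = \sum_n u n d.
  by apply: (big_morph (fun v : completion g => v d)).
rewrite coef_sum (bigD1 (Ordinal lt_dN)) //= (eqP (tr_qsym_homog d)).
rewrite big1 ?addr0 // => n ne_nd; rewrite -(eqP (tr_qsym_homog n)) gcomp_id.
by case: eqP => // Dd; rewrite -val_eqE /= -Dd eqxx in ne_nd.
Qed.

(** In degree n of the Cauchy product, each J contributes only at the index i = |J|; this leaves
    [sum_qdet_tr_qsym]. *)
Lemma Ferm_mul_tr_qsym : to_completion g (Ferm q A) * tr_qsym_completion = 1.
Proof.
apply: completion_ext => n /=; rewrite gcomp_one -sum_qdet_tr_qsym.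
under eq_bigr => i _ do rewrite gcomp_Ferm mulr_suml.
rewrite (exchange_big_dep (fun J : {set 'I_r} => (#|J| <= n)%N)) /=; last first.
  by move=> i J _ /eqP->; rewrite -ltnS.
apply: eq_bigr => J leJ; rewrite (big_pred1 (Ordinal (leJ : (#|J| < n.+1)%N))) => [|i].
  by rewrite scalerAl.
exact: eq_sym.
Qed.

End BosonFermion.

(** With e = v u - 1 one has u e = 0. As u has constant term 1, the degree n part of u e is e_n once
    the lower parts of e vanish, so e = 0 by induction. *)
Lemma completion_mul1C (R : nzRingType) (g : grading R) (u v : completion g) :
  u 0%N = 1 -> u * v = 1 -> v * u = 1.
Proof.
move=> u0 uv1; apply/eqP; rewrite -subr_eq0; apply/eqP; set e := _ - _.
have ue0 : u * e = 0 by rewrite mulrBr mulrA uv1 mul1r mulr1 subrr.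
clearbody e; apply: completion_ext => n; elim/ltn_ind: n => n IHn.
have := congr1 (fun w : completion g => w n) ue0 => /=.
rewrite big_ord_recl /= u0 mul1r subn0 big1 ?addr0 // => i _.
rewrite IHn /= ?mulr0 // ltn_subrL /=.
exact: leq_ltn_trans (leq0n i) (ltn_ord i).
Qed.

(** * The algebra of quantum matrices *)

Section QuantumMatrices.
Context {K : comUnitRingType} (q : K) (r : nat).

Lemma qmat_gen_right_quantum : right_quantum q (qmat_gen q r).
Proof.
split=> [i i' j lt_ii'|i i' j j' lt_ii' lt_jj']; last first.
  by have [_ []] := qmat_genP q lt_ii' lt_jj'.
(* The relations are given for 2 x 2 submatrices, so a second column is needed; i and i' are
   distinct, so one of them differs from j. *)
have [j' ne_jj'] : exists j' : 'I_r, j != j'.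
  have [->|] := eqVneq j i; last by exists i.
  by exists i'; rewrite -val_eqE ltn_eqF.
move: ne_jj'; rewrite -val_eqE neq_ltn => /orP[lt_jj'|lt_j'j].
  by have [[]] := qmat_genP q lt_ii' lt_jj'.
by have [[]] := qmat_genP q lt_ii' lt_j'j.
Qed.

(** [grading] speaks of the ring structure only, so stability of the components under K is a
    separate fact. *)
Lemma qmat_homogZ (c : K) n (x : qmat q r) :
  x \in homog (qmat_grading q r) n -> c *: x \in homog (qmat_grading q r) n.
Proof.
rewrite !inE /= => /eqP {2}<-; have [x' ->] := qmat_surj x.
by rewrite -alg_piZ !qmat_compE free_compZ alg_piZ.
Qed.

End QuantumMatrices.

Theorem theorem2 (K : comUnitRingType) (q : K) (hq : q \is a GRing.unit)
    (r : nat) (hr : (1 <= r)%N) :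
  let A : 'M[qmat q r]_r := qmat_gen q r in
  let iota : qmat q r -> completion (qmat_grading q r) :=
    to_completion (qmat_grading q r) in
  iota (Ferm q A) \is a GRing.unit /\
  completion_series (fun n : nat => iota (\tr (qsym q n A)))
    (iota (Ferm q A))^-1.
Proof.
move=> A iota; pose g := qmat_grading q r.
have rqA : right_quantum q A := qmat_gen_right_quantum q r.
have hZ := @qmat_homogZ K q r.
have hA : forall i j, A i j \in homog g 1 := qmat_gen_homog q (r := r).
pose bos := tr_qsym_completion q hZ hA.
have FB : iota (Ferm q A) * bos = 1 := Ferm_mul_tr_qsym hq rqA hZ hA.
have F0 : iota (Ferm q A) 0%N = 1 := gcomp0_Ferm q hZ hA.
(* Units of the completion have two-sided inverses; the constant term 1 supplies the other side. *)
have BF : bos * iota (Ferm q A) = 1 := completion_mul1C F0 FB.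
have unitF : iota (Ferm q A) \is a GRing.unit := completion_unitP (conj BF FB).
split=> //; have -> : (iota (Ferm q A))^-1 = bos; last exact: tr_qsym_series.
by rewrite -[bos]mulr1 -(mulrV unitF) mulrA BF mul1r.
Qed.
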